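(* Let $K_{\hat\vartheta}=\sup_{x\in\mathbb{R}}|F_{\hat\vartheta}(x)-F_\vartheta(x)|$ with $\hat\vartheta=(\hat\mu,\hat\sigma)$. Then the distribution of $K_{\hat\vartheta}$ under $P_\vartheta$ does not depend on $\vartheta$ and $$K_{\hat\vartheta}\overset{d}{=}\max\{U,V\},$$ where $U=1-\exp\{-S\}$ and $$V=|1-T|\exp\Big\{\frac{S-T\ln(T)}{T-1}\Big\}\big(\mathbb{1}_{\{T<1\}}+\mathbb{1}_{\{S<\ln(T)\}}\big),$$ with $S$ exponentially distributed with mean $1/n$ (i.e. $S\sim F_{(0,1/n)}$) and $T\sim\Gamma(m-1,1/m)$ independent. Consequently, for $p\in(0,1)$ and $d_p=d_p(m,n)$ the $(1-p)$-quantile of $K_{\hat\vartheta}$, the set $$B_4=\{(x,y)\in\mathbb{R}^2:\ |F_{\hat\vartheta}(x)-y|\le d_p\}$$ is a confidence band for $F_\vartheta$ with exact confidence level $1-p$.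
   Context: Let $1<m\le n$ be integers and $(R_1,\dots,R_m)\in\mathbb{N}_0^m$ with $\sum_{j=1}^mR_j=n-m$; set $\gamma_j=\sum_{i=j}^m(R_i+1)$. A sample of progressively type-II censored order statistics $X=(X_{1:m:n},\dots,X_{m:m:n})$ from an absolutely continuous cdf $F$ with density $f$ has joint density $\prod_{j=1}^m\gamma_jf(x_j)[1-F(x_j)]^{R_j}$ on $x_1\le\dots\le x_m$. Here $F=F_\vartheta$ belongs to the exponential location-scale family: for $\vartheta=(\mu,\sigma)\in\Theta=\mathbb{R}\times(0,\infty)$, $F_\vartheta(x)=1-\exp\{-(x-\mu)/\sigma\}$ for $x>\mu$ and $F_\vartheta(x)=0$ for $x\le\mu$; $\vartheta$ is unknown and $P_\vartheta$ denotes the underlying probability. The MLEs are $\hat\mu=X_{1:m:n}$ and $\hat\sigma=\frac1m\sum_{j=2}^m\gamma_j(X_{j:m:n}-X_{j-1:m:n})$. $\Gamma(a,b)$ is the gamma distribution with shape $a$ and scale $b$. $\mathrm{graph}\,F=\{(t,F(t)):t\in\mathbb{R}\}$. A confidence band is a random subset $B$ of $\mathbb{R}^2$ such that $\{\mathrm{graph}\,F_\vartheta\subseteq B\}$ is measurable and the vertical sections $\{y:(t,y)\in B\}$ are a.s. intervals; it has exact confidence level $1-p$ if $P_\vartheta(\mathrm{graph}\,F_\vartheta\subseteq B)=1-p$ for all $\vartheta\in\Theta$. *)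

(* Defs.v *)
From HB Require Import structures.
From mathcomp Require Import all_boot all_order all_algebra.
From mathcomp Require Import all_classical all_reals all_analysis.
Set Implicit Arguments. Unset Strict Implicit. Unset Printing Implicit Defensive.
Import Order.TTheory GRing.Theory Num.Theory.
Import numFieldNormedType.Exports.
Local Open Scope classical_set_scope.
Local Open Scope ring_scope.

Section defs.
Context {R : realType}.

Definition Fexp (mu sigma : R) (x : R) : R :=
  if x <= mu then 0 else 1 - expR (- (x - mu) / sigma).

Definition fexp (mu sigma : R) (x : R) : R :=
  if x <= mu then 0 else sigma^-1 * expR (- (x - mu) / sigma).

(* gamma_j = sum_{i=j}^{m} (R_i + 1), 0-based indices j, i < m *)
Definition gam (m : nat) (Rs : nat -> nat) (j : nat) : nat :=
  \sum_(j <= i < m) (Rs i).+1.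

(* joint density of progressively type-II censored order statistics
   (X_{1:m:n},...,X_{m:m:n}) stored at 0-based positions 0..m-1 of s *)
Definition pcos_density (m : nat) (Rs : nat -> nat) (mu sigma : R)
    (s : seq R) : R :=
  if sorted <=%R s then
    \prod_(j < m) ((gam m Rs j)%:R * fexp mu sigma (nth 0 s j)
                   * (1 - Fexp mu sigma (nth 0 s j)) ^+ Rs j)
  else 0.

Fixpoint iint (k : nat) (g : seq R -> \bar R) : \bar R :=
  match k with
  | 0 => g [::]
  | k'.+1 => (\int[@lebesgue_measure R]_x iint k' (fun s => g (x :: s)))%E
  end.

Definition gamma_pdf (a : nat) (b : R) (x : R) : R :=
  if x <= 0 then 0
  else x ^+ a.-1 * expR (- x / b) / ((a.-1)`!%:R * b ^+ a).

Definition graph (F : R -> R) : set (R * R) := [set tF | tF.2 = F tF.1].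

Definition quantile d (Omega : measurableType d) (P : probability Omega R)
    (K : Omega -> R) (q : R) : R :=
  inf [set t : R | (q%:E <= P [set w | (K w <= t)%R])%E].

End defs.

(* X = (X_0,...,X_{m-1}) is a sample of progressively type-II censored order
   statistics with censoring scheme Rs from F_(mu,sigma) under P:
   each X_j is measurable and (X_0,...,X_{m-1}) has the joint density
   pcos_density, i.e. its joint cdf is the m-fold integral of that density. *)
Definition is_pcos_sample {R : realType} d (Omega : measurableType d)
    (P : probability Omega R) (m : nat) (Rs : nat -> nat) (mu sigma : R)
    (X : nat -> Omega -> R) : Prop :=
  (forall j, (j < m)%N -> measurable_fun setT (X j)) /\
  forall a : nat -> R,
    P [set w | forall j, (j < m)%N -> X j w <= a j] =
    iint m (fun s => ((if [forall j : 'I_m, nth 0 s j <= a j] then 1 else 0)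
                      * pcos_density m Rs mu sigma s)%:E).

Definition mu_hat {R : realType} (Omega : Type) (X : nat -> Omega -> R)
  (w : Omega) : R := X 0%N w.

Definition sigma_hat {R : realType} (Omega : Type) (m : nat) (Rs : nat -> nat)
    (X : nat -> Omega -> R) (w : Omega) : R :=
  m%:R^-1 * \sum_(1 <= j < m) (gam m Rs j)%:R * (X j w - X j.-1 w).

Definition K_hat {R : realType} (Omega : Type) (m : nat) (Rs : nat -> nat)
    (X : nat -> Omega -> R) (mu sigma : R) (w : Omega) : R :=
  sup (range (fun x : R =>
    `|Fexp (mu_hat X w) (sigma_hat m Rs X w) x - Fexp mu sigma x|)).

Definition exact_confidence_band {R : realType} d (Omega : measurableType d)
    (P : R -> R -> probability Omega R) (F : R -> R -> R -> R)
    (B : Omega -> set (R * R)) (lvl : R) : Prop :=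
  forall mu sigma, 0 < sigma ->
    [/\ measurable [set w | graph (F mu sigma) `<=` B w],
        (exists N : set Omega, [/\ measurable N, P mu sigma N = 0%E &
           forall w, ~ N w -> forall t, is_interval [set y | B w (t, y)]]) &
        P mu sigma [set w | graph (F mu sigma) `<=` B w] = lvl%:E].

(* Main.v *)
Require Import Defs.
From HB Require Import structures.
From mathcomp Require Import all_boot all_order all_algebra.
From mathcomp Require Import all_classical all_reals all_analysis.
From mathcomp Require Import measurable_realfun ring lra.
Set Implicit Arguments. Unset Strict Implicit. Unset Printing Implicit Defensive.
Import Order.TTheory GRing.Theory Num.Theory.
Import numFieldNormedType.Exports.
Local Open Scope classical_set_scope.
Local Open Scope ring_scope.

(* The joint density factors so that the order statistics form a random walk:
   the scaled spacings gamma_j (X_j - X_(j-1)) are i.i.d. exponential.  The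
   joint cdf is rewritten as an iterated expectation over such a walk; running
   along the observations and replacing, one at a time, the half-lines by
   arbitrary Borel sets (uniqueness of measures on products) yields the joint
   law of X_0 and of the sum of the later scaled spacings, i.e. of the
   independent pivots S = (mu_hat - mu) / sigma ~ Exp(mean 1/n) and
   T = sigma_hat / sigma ~ Gamma(m - 1, 1/m), the latter by convolution.
   For S >= 0 and T > 0 the Kolmogorov distance is a function of (S, T) alone,
   and the two bounds that identify the supremum with max(U, V) both follow from
   the convexity inequality exp(l x) <= l exp(x) + 1 - l.
   Given T, the value max(U, V) = c determines S > 0 up to two points, so K has
   no atoms and its quantile is attained exactly. *)

(** * Uniqueness and densities of measures *)

(** The sample is known only through its joint cdf, a nest of one-dimensional integrals. Instead of
    changing variables in dimension m, the observations are folded into a state of fixed dimension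
    (first value, running sum, last value) whose law is followed one observation at a time.
    Integrating out the coordinates from j on leaves the factor exp(-gamma_j (y - mu) / sigma), with
    y the last value seen: the survival of the gamma_j units still on test. Since gamma_j = R_j + 1
    + gamma_(j+1), this factor merges with the preceding density factor, so the next increment is
    exponential of rate gamma_j / sigma whatever y is. On the analytic side, V is the distance at
    the point where the two densities cross, and its indicators tell whether that point lies to the
    right of s. A negative [sigma_hat] has probability zero, yet it has to be treated: there the
    supremum is over an unbounded set and takes a default value, which measurability of K must
    cover. *)

Section measure_tools.
Context {R : realType}.
Local Open Scope ereal_scope.

(** The sigma type delivers a bundled measure under an abstract name, to which the uniqueness lemmas
    below apply directly. *)
Lemma density_measure d (T : measurableType d) (mu : {measure set T -> \bar R})
    (f : T -> \bar R) : measurable_fun setT f -> (forall x, 0 <= f x) ->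
  {nu : {measure set T -> \bar R} | forall A, nu A = \int[mu]_(x in A) f x}.
Proof.
move=> mf f0; pose nu A := \int[mu]_(x in A) f x.
have nu0 : nu set0 = 0 by rewrite /nu integral_set0.
have nu_ge0 A : 0 <= nu A by exact: integral_ge0.
have nus : semi_sigma_additive nu := semi_sigma_additive_nng_induced mf f0.
pose M := isMeasure.Build _ _ _ nu nu0 nu_ge0 nus.
pose N : {measure set T -> \bar R} := HB.pack nu M.
by exists N.
Qed.

Lemma image_measure d1 d2 (T1 : measurableType d1) (T2 : measurableType d2)
    (mu : {measure set T1 -> \bar R}) (f : T1 -> T2) : measurable_fun setT f ->
  {nu : {measure set T2 -> \bar R} | forall A, nu A = mu (f @^-1` A)}.
Proof.
move=> mf.
by unshelve refine (exist _ (pushforward mu f : {measure set T2 -> \bar R}) _).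
Qed.

Import HBNNSimple.

(** Monotone convergence along simple functions, then finite sums over their values, reduce the
    claim to indicators, where it is the hypothesis on [nu]. *)
Lemma ge0_integral_density d (T : measurableType d)
    (mu nu : {measure set T -> \bar R}) (f : T -> R) (g : T -> \bar R) :
  measurable_fun setT f -> (forall x, 0 <= f x)%R ->
  (forall A, measurable A -> nu A = \int[mu]_(x in A) (f x)%:E) ->
  measurable_fun setT g -> (forall x, 0 <= g x) ->
  \int[nu]_x g x = \int[mu]_x (g x * (f x)%:E).
Proof.
move=> mf f0 nuE mg g0.
have mEf : measurable_fun setT (EFin \o f) by exact/measurable_EFinP.
pose h := nnsfun_approx measurableT mg.
have hg x : (EFin \o h n) x @[n --> \oo] --> g x.
  by apply: cvg_nnsfun_approx.
transitivity (lim (\int[nu]_x (h n x)%:E @[n --> \oo])).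
  rewrite -monotone_convergence//.
  - by apply: eq_integral => x _; apply/esym/cvg_lim => //; exact: hg.
  - by move=> n; exact/measurable_EFinP.
  - by move=> n x _; rewrite lee_fin.
  - by move=> x _ a b ab; rewrite lee_fin; exact/lefP/nd_nnsfun_approx.
transitivity (lim (\int[mu]_x ((h n x)%:E * (f x)%:E) @[n --> \oo])); last first.
  rewrite -monotone_convergence//.
  - apply: eq_integral => x _; apply/cvg_lim => //.
    by apply: cvgeZr => //; exact: hg.
  - by move=> n; apply: emeasurable_funM => //; exact/measurable_EFinP.
  - by move=> n x _; rewrite -EFinM lee_fin mulr_ge0.
  - move=> x _ a b ab; rewrite -!EFinM lee_fin ler_wpM2r//.
    exact/lefP/nd_nnsfun_approx.
suff suf n : \int[nu]_x (h n x)%:E = \int[mu]_x ((h n x)%:E * (f x)%:E).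
  by under eq_fun do rewrite suf.
have mind (r : R) : measurable_fun setT (fun x => (r * \1_(h n @^-1` [set r]) x)%:E).
  by apply/measurable_EFinP/measurable_funM.
transitivity (\sum_(y \in range (h n)) \int[nu]_x (y * \1_(h n @^-1` [set y]) x)%:E).
  rewrite -ge0_integral_fsum//; last by move=> r x _; exact: nnfun_muleindic_ge0.
  by apply: eq_integral => x _; rewrite fsumEFin// -fimfunE.
transitivity (\sum_(y \in range (h n))
    \int[mu]_x ((y * \1_(h n @^-1` [set y]) x)%:E * (f x)%:E)); last first.
  rewrite -ge0_integral_fsum//.
  - apply: eq_integral => x _.
    rewrite -ge0_mule_fsuml => [|y]; last exact: nnfun_muleindic_ge0.
    by rewrite fsumEFin// -fimfunE.
  - by move=> r; exact: emeasurable_funM.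
  - by move=> r x _; rewrite mule_ge0 ?lee_fin//; exact: nnfun_muleindic_ge0.
apply: eq_fsbigr => r rhn.
have r0 : (0 <= r)%R by move: rhn; rewrite inE => -[t _ <-].
under [RHS]eq_integral do rewrite EFinM -muleA.
under eq_integral do rewrite EFinM.
have mI : measurable_fun setT (fun x => (\1_(h n @^-1` [set r]) x)%:E : \bar R).
  by apply/measurable_EFinP; exact: measurable_indic.
rewrite [LHS](ge0_integralZl_EFin _ measurableT)//.
rewrite (ge0_integralZl_EFin _ measurableT)//; last 2 first.
- by move=> x _; rewrite -EFinM lee_fin mulr_ge0.
- exact: emeasurable_funM.
congr (_ * _); rewrite integral_indic// setIT nuE// [LHS]integral_mkcond.
apply: eq_integral => x _; rewrite patchE indicE.
by case: (x \in _); rewrite ?mul1e ?mul0e.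
Qed.

(** The right-hand side is a measure in A giving half-open intervals their length, hence it is
    Lebesgue measure. *)
Lemma lebesgue_measure_affine (a c : R) (A : set R) : (0 < c)%R -> measurable A ->
  lebesgue_measure A =
  c%:E * lebesgue_measure ((fun x => a + c * x)%R @^-1` A).
Proof.
move=> c0 mA.
have mphi : measurable_fun setT
    (fun x : measurableTypeR R => (a + c * x)%R : measurableTypeR R).
  by apply: measurable_funD => //; apply: measurable_funM.
pose cn : {nonneg R} := NngNum (ltW c0).
pose M : {mfun measurableTypeR R >-> measurableTypeR R} :=
  HB.pack (fun x : measurableTypeR R => (a + c * x)%R : measurableTypeR R)
   (isMeasurableFun.Build _ _ _ _ _ mphi).
have H := @lebesgue_measure_unique R (mscale cn (pushforward lebesgue_measure M)).
rewrite H//= => _ [[u v]] _ <-.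
rewrite /mscale/= /pushforward.
have -> : M @^-1` `]u, v]%classic = `]((u - a) / c)%R, ((v - a) / c)%R]%classic.
  apply/seteqP; split => x /=; rewrite !in_itv/= ltr_pdivrMr// ler_pdivlMr//;
    rewrite ltrBlDr lerBrDr (addrC _ a) (mulrC c) => /andP[-> ->]//.
rewrite !lebesgue_measure_itv/= !lte_fin ltr_pM2r ?invr_gt0// ltrD2r.
case: ifPn => _; last by rewrite mule0.
rewrite -!EFinB -EFinM; congr EFin.
by rewrite -mulrBl mulrCA divff ?gt_eqF// mulr1; lra.
Qed.

Lemma ge0_integral_affine (a c : R) (f : R -> \bar R) : (0 < c)%R ->
  measurable_fun setT f -> (forall x, 0 <= f x) ->
  \int[lebesgue_measure]_x f x =
  c%:E * \int[lebesgue_measure]_x f (a + c * x)%R.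
Proof.
move=> c0 mf f0.
have mphi : measurable_fun setT
    (fun x : measurableTypeR R => (a + c * x)%R : measurableTypeR R).
  by apply: measurable_funD => //; apply: measurable_funM.
pose M : {mfun measurableTypeR R >-> measurableTypeR R} :=
  HB.pack (fun x : measurableTypeR R => (a + c * x)%R : measurableTypeR R)
   (isMeasurableFun.Build _ _ _ _ _ mphi).
pose cn : {nonneg R} := NngNum (ltW c0).
have := @ge0_integral_pushforward _ _ _ _ R M mphi lebesgue_measure setT f
  measurableT mf (fun y _ => f0 y).
rewrite preimage_setT /= => <-.
rewrite -[c%:E]/(cn%:num%:E) -ge0_integral_mscale//.
apply: eq_measure_integral => A mA _ /=.
by rewrite (lebesgue_measure_affine a c0 mA).
Qed.

Lemma measure_unique_Nyitv (m1 m2 : {measure set R -> \bar R}) :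
  m1 setT < +oo ->
  (forall b, m1 `]-oo, b]%classic = m2 `]-oo, b]%classic) ->
  forall A, measurable A -> m1 A = m2 A.
Proof.
move=> m1oo m12.
pose G : set (set R) := [set A | exists x, A = `]-oo, x]%classic].
apply: (measure_unique G (fun n => `]-oo, n%:R]%classic)).
- rewrite [LHS](_ : _ = (@RGenOInfty.G R).-sigma.-measurable); last first.
    exact: RGenOInfty.measurableE.
  rewrite eqEsubset; split => A.
    apply: smallest_sub; first exact: smallest_sigma_algebra.
    move=> _ [x ->]; rewrite -setCitvl.
    rewrite -setTD; have [_ + _] := smallest_sigma_algebra setT G; apply.
    by apply: sub_sigma_algebra; exists x.
  apply: smallest_sub; first exact: smallest_sigma_algebra.
  move=> _ [x ->]; rewrite -setCitvr -setTD.
  have [_ + _] := smallest_sigma_algebra setT (@RGenOInfty.G R); apply.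
  by apply: sub_sigma_algebra; exists x.
- move=> _ _ [x ->] [y ->]; exists (Num.min x y).
  apply/seteqP; split => z /=; rewrite !in_itv/= le_min; first by move=> [-> ->].
  by move=> /andP[].
- by move=> i; exists i%:R.
- rewrite -subTset => x _; exists (Num.truncn x).+1 => //=.
  by rewrite in_itv/= ltW// truncnS_gt.
- by move=> _ [x ->].
- move=> k; apply: le_lt_trans m1oo; apply: le_measure; rewrite ?inE//.
Qed.

Lemma measure_unique_prod d1 d2 (T1 : measurableType d1) (T2 : measurableType d2)
    (m1 m2 : {measure set (T1 * T2) -> \bar R}) :
  m1 setT < +oo ->
  (forall A B, measurable A -> measurable B -> m1 (A `*` B) = m2 (A `*` B)) ->
  forall D, measurable D -> m1 D = m2 D.
Proof.
move=> m1oo m12.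
pose G : set (set (T1 * T2)) :=
  [set A `*` B | A in measurable & B in measurable].
apply: (measure_unique G (fun=> setT)).
- by rewrite measurable_prod_measurableType.
- move=> _ _ [A1 mA1 [B1 mB1 <-]] [A2 mA2 [B2 mB2 <-]].
  rewrite -setXI; exists (A1 `&` A2); first exact: measurableI.
  by exists (B1 `&` B2) => //; exact: measurableI.
- by move=> _; exists setT => //; exists setT => //; rewrite setXTT.
- by rewrite bigcup_const//; exists 0%N.
- by move=> _ [A mA [B mB <-]]; exact: m12.
- by [].
Qed.

(** For a fixed A, restricting to the strip over A and projecting to the second factor gives two
    measures on the line that agree on half-lines. This is what turns one cdf coordinate at a time
    into an arbitrary Borel set. *)
Lemma measure_unique_prod_Nyitv d (T : measurableType d)
    (m1 m2 : {measure set (T * R) -> \bar R}) :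
  m1 setT < +oo ->
  (forall C b, measurable C ->
     m1 (C `*` `]-oo, b]%classic) = m2 (C `*` `]-oo, b]%classic)) ->
  forall D, measurable D -> m1 D = m2 D.
Proof.
move=> m1oo m12; apply: measure_unique_prod => // A B mA mB.
have mAT : measurable (A `*` [set: R]) by exact: measurableX.
have msnd : measurable_fun setT (@snd T R) by exact: measurable_snd.
have [n1 n1E] := image_measure (mrestr m1 mAT) msnd.
have [n2 n2E] := image_measure (mrestr m2 mAT) msnd.
have sE (C : set R) : snd @^-1` C `&` (A `*` [set: R]) = A `*` C.
  by apply/seteqP; split => -[x y] /= [] => [? []|].
have {}n1E C : n1 C = m1 (A `*` C) by rewrite n1E /= /mrestr sE.
have {}n2E C : n2 C = m2 (A `*` C) by rewrite n2E /= /mrestr sE.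
rewrite -n1E -n2E; apply: measure_unique_Nyitv => //.
- rewrite n1E; apply: le_lt_trans m1oo; apply: le_measure; rewrite ?inE//.
- by move=> b; rewrite n1E n2E m12.
Qed.

End measure_tools.

(** * Iterated expectations over a random walk *)

Section walk.
Context {R : realType}.
Local Open Scope ereal_scope.

(* probability that the walk y, y + c_j e_j, y + c_j e_j + c_(j+1) e_(j+1), ...
   with i.i.d. noise of law E stays below a_j, ..., a_(j+k-1) in its k steps *)
Fixpoint walk_le (E : {measure set R -> \bar R}) (c a : nat -> R)
    (k j : nat) (y : R) : \bar R :=
  match k with
  | 0%N => 1
  | k'.+1 => \int[E]_e ((\1_(`]-oo, a j]%classic) (y + c j * e)%R)%:E *
                        walk_le E c a k' j.+1 (y + c j * e)%R)
  end.

Lemma walk_le_ge0 E c a k j y : 0 <= walk_le E c a k j y.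
Proof.
elim: k j y => [|k IH] j y /=; first exact: lee01.
by apply: integral_ge0 => e _; rewrite mule_ge0// lee_fin.
Qed.

Lemma eq_walk_le E c a a' k j y : (forall i, (j <= i)%N -> a i = a' i) ->
  walk_le E c a k j y = walk_le E c a' k j y.
Proof.
elim: k j y => [//|k IH] j y aa' /=; apply: eq_integral => e _.
by rewrite aa'// IH// => i /ltnW/aa'.
Qed.

Variable E : probability R R.
Variable c : nat -> R.

Lemma measurable_affine2 (s : R) :
  measurable_fun setT (fun ye : R * R => ye.1 + s * ye.2)%R.
Proof.
apply: measurable_funD; first exact: measurable_fst.
by apply: measurable_funM => //; exact: measurable_snd.
Qed.

Lemma measurable_walk_le a k j : measurable_fun setT (walk_le E c a k j).
Proof.
elim: k j => [|k IH] j /=; first exact: measurable_cst.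
pose f (ye : R * R) := (\1_(`]-oo, a j]%classic) (ye.1 + c j * ye.2)%R)%:E *
                        walk_le E c a k j.+1 (ye.1 + c j * ye.2)%R.
have mf : measurable_fun setT f.
  have mA := measurable_affine2 (c j).
  apply: emeasurable_funM; last exact: (measurableT_comp (IH _)).
  by apply/measurable_EFinP; apply: (measurableT_comp _ mA); exact: measurable_indic.
apply: (measurable_fun_fubini_tonelli_F (m2 := E) f mf) => x.
by rewrite mule_ge0 ?lee_fin ?walk_le_ge0.
Qed.

Context d (Omega : measurableType d) (P : probability Omega R).
Context d' (Z : measurableType d').
Variables (m : nat) (X : nat -> Omega -> R) (z0 : Z) (cur : Z -> R)
  (upd : nat -> Z * R -> Z).
Hypothesis mX : forall j, (j < m)%N -> measurable_fun setT (X j).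
Hypothesis mcur : measurable_fun setT cur.
Hypothesis mupd : forall j, measurable_fun setT (upd j).
Hypothesis cur_upd : forall j zx, cur (upd j zx) = zx.2.
Hypothesis X_walk : forall a : nat -> R,
  P [set w | forall j, (j < m)%N -> (X j w <= a j)%R] = walk_le E c a m 0 (cur z0).

Fixpoint state (j : nat) (w : Omega) : Z :=
  if j is j'.+1 then upd j' (state j' w, X j' w) else z0.

(** Counterpart of [state] for the ideal walk: the update receives the position reached with fresh
    noise in place of an observation. *)
Definition step (j : nat) (ze : Z * R) : Z :=
  upd j (ze.1, (cur ze.1 + c j * ze.2)%R).

Lemma measurable_next j :
  measurable_fun setT (fun ze : Z * R => (ze.1, (cur ze.1 + c j * ze.2)%R)).
Proof.
apply: measurable_fun_pair; first exact: measurable_fst.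
apply: measurable_funD; first exact: (measurableT_comp mcur measurable_fst).
by apply: measurable_funM => //; exact: measurable_snd.
Qed.

Lemma measurable_step j : measurable_fun setT (step j).
Proof. exact: (measurableT_comp (mupd j) (measurable_next j)). Qed.

HB.instance Definition _ j := isMeasurableFun.Build _ _ _ _ (step j) (measurable_step j).

Fixpoint state_law (j : nat) : probability Z R :=
  if j is j'.+1 then
    distribution (state_law j' \x E : probability (Z * R)%type R) (step j')
  else \d_z0.

Lemma state_lawS j A :
  state_law j.+1 A = (state_law j \x E) (step j @^-1` A).
Proof. by []. Qed.

Lemma measurable_state j : (j <= m)%N -> measurable_fun setT (state j).
Proof.
elim: j => [|j IH] jm /=; first exact: measurable_cst.
apply: (measurableT_comp (mupd j)).
by apply: measurable_fun_pair; [exact/IH/ltnW|exact: mX].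
Qed.

Let rest (a : nat -> R) j := [set w | forall i, (j <= i < m)%N -> (X i w <= a i)%R].

Let mrest a j : measurable (rest a j).
Proof.
have -> : rest a j = \bigcap_(i in [set i | (j <= i < m)%N]) X i @^-1` `]-oo, a i].
  by apply/seteqP; split => w /= h i /= /h; rewrite /= in_itv.
apply: bigcap_measurableType => i /= /andP[_ im].
by rewrite -[X in measurable X]setTI; exact: mX.
Qed.

(** Interpolates between the two descriptions of the sample: at j = 0 all coordinates are still
    bounded by half-lines, which is the hypothesis on the cdf; at j = m none is left and the law of
    the state remains. *)
Lemma state_law_rest j (C : set Z) (a : nat -> R) : (j <= m)%N -> measurable C ->
  P (state j @^-1` C `&` rest a j) =
  \int[state_law j]_(z in C) walk_le E c a (m - j) j (cur z).
Proof.
elim: j C a => [|j IH] C a jm mC.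
  rewrite /= integral_dirac//; last first.
    exact/measurable_funTS/(measurableT_comp (measurable_walk_le _ _ _) mcur).
  rewrite subn0 -X_walk diracE.
  have -> : rest a 0 = [set w | forall j, (j < m)%N -> (X j w <= a j)%R] by [].
  have [zC|zC] := boolP (z0 \in C); rewrite ?mul1e ?mul0e.
    congr (P _); apply/seteqP; split => w /=; first by case.
    by split => //; exact: set_mem.
  rewrite (_ : _ `&` _ = set0) ?measure0//; apply/seteqP; split => w //= -[+ _].
  by move/mem_set; rewrite (negbTE zC).
set k := (m - j.+1)%N.
have mjk : (m - j = k.+1)%N by rewrite subnSK.
pose G (ze : Z * R) := walk_le E c a k j.+1 (cur ze.1 + c j * ze.2)%R.
have mG : measurable_fun setT G.
  apply: (measurableT_comp (measurable_walk_le a k j.+1)).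
  exact: (measurableT_comp (measurable_snd) (measurable_next j)).
have G0 ze : 0 <= G ze by exact: walk_le_ge0.
have mZX : measurable_fun setT (fun w => (state j w, X j w)).
  by apply: measurable_fun_pair; [exact/measurable_state/ltnW|exact: mX].
(* Both [m1] and [m2] describe the pair (state, next observation) on the event that the later
   observations stay below [a]: [m1] from the sample, [m2] from the walk, weighted by the chance [G]
   of the remaining steps. *)
have [m1 m1E] := image_measure (mrestr P (mrest a j.+1)) mZX.
have [nu nuE] := density_measure (state_law j \x E) mG G0.
have [m2 m2E] := image_measure nu (measurable_next j).
have m12 D : measurable D -> m1 D = m2 D.
  apply: measure_unique_prod_Nyitv => [|{D C mC} C b mC].
    by rewrite m1E /= /mrestr -ge0_fin_numE// fin_num_measure// preimage_setT setTI.
  (* Moving only the j-th threshold makes the induction hypothesis give the mass of every rectangle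
     with a half-line as second side. *)
  pose a' i := if i == j then b else a i.
  have -> : m1 (C `*` `]-oo, b]%classic) = P (state j @^-1` C `&` rest a' j).
    rewrite m1E /= /mrestr; congr (P _); apply/seteqP; split => w /=.
      move=> [[ZC]]; rewrite in_itv/= => Xb Xa; split=> // i /andP[].
      rewrite leq_eqVlt /a' => /predU1P[<- _|ji im]; first by rewrite eqxx.
      by rewrite gtn_eqF// Xa// ji.
    move=> [ZC Xa]; split; [split => //|].
      by rewrite in_itv/=; have := Xa j; rewrite leqnn jm /a' eqxx => ->.
    move=> i /andP[ji im]; have := Xa i; rewrite (ltnW ji) im => /(_ isT).
    by rewrite /a' gtn_eqF.
  rewrite IH ?(ltnW jm)// mjk m2E nuE /=.
  rewrite [LHS]integral_mkcond [RHS]integral_mkcond.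
  rewrite fubini_tonelli1//; last 2 first.
  - apply/(measurable_restrictT _ _).1 => //.
      rewrite -[X in measurable X]setTI; apply: measurable_next => //.
      exact: measurableX.
    exact: measurable_funTS.
  - by move=> ze; rewrite patchE; case: ifP.
  apply: eq_integral => z _; rewrite /fubini_F patchE.
  case: ifPn => zC.
    apply: eq_integral => e _; rewrite patchE indicE [a' j]/a' eqxx.
    rewrite (_ : ((z, e) \in _) = ((cur z + c j * e)%R \in `]-oo, b]%classic)).
      case: ifPn => _; rewrite ?mul1e ?mul0e//.
      by apply: eq_walk_le => i ji; rewrite /a' gtn_eqF.
    apply/idP/idP; rewrite !inE /=; first by case.
    by split => //; exact: set_mem.
  rewrite integral0_eq// => e _; rewrite patchE ifF//.
  by apply/negbTE; apply: contra zC; rewrite !inE /= => -[].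
have -> : state j.+1 @^-1` C `&` rest a j.+1 =
    (fun w => (state j w, X j w)) @^-1` (upd j @^-1` C) `&` rest a j.+1 by [].
have mU : measurable (upd j @^-1` C).
  by rewrite -[X in measurable X]setTI; exact: mupd.
have := m12 _ mU; rewrite m1E /= /mrestr => ->.
rewrite m2E nuE /distribution ge0_integral_pushforward//.
- by apply: eq_integral => z _; rewrite /G /= cur_upd.
- exact/measurable_funTS/(measurableT_comp (measurable_walk_le _ _ _) mcur).
- by move=> z _; exact: walk_le_ge0.
Qed.

End walk.

(** * Exponential noise *)

(** Absorbs conventions at a boundary point: [gamma_pdf] vanishes at 0 while [exponential_pdf] does
    not. *)
Lemma eq_integral_off1 (R : realType) (r : R) (f g : R -> \bar R) :
  measurable_fun setT f -> measurable_fun setT g ->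
  (forall x, x != r -> f x = g x) ->
  (\int[lebesgue_measure]_x f x = \int[lebesgue_measure]_x g x)%E.
Proof.
move=> mf mg fg.
have mr : measurable ([set: R] `\ r) by exact: measurableD.
rewrite -[LHS](@integral_setD1 R _ r setT)//; last exact: measurable_funTS.
rewrite -[RHS](@integral_setD1 R _ r setT)//; last exact: measurable_funTS.
by apply: eq_integral => x; rewrite inE /= => -[_ /eqP /fg].
Qed.

(* R and measurableTypeR R carry the same sigma-algebra under different
   displays, hence the transfer along the identity *)
Lemma ge0_integral_density_lebesgue (R : realType)
    (nu : {measure set R -> \bar R}) (f : R -> R) (g : R -> \bar R) :
  measurable_fun setT f -> (forall x, 0 <= f x) ->
  (forall A, measurable A -> nu A = \int[lebesgue_measure]_(x in A) (f x)%:E)%E ->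
  measurable_fun setT g -> (forall x, 0 <= g x)%E ->
  (\int[nu]_x g x = \int[lebesgue_measure]_x (g x * (f x)%:E))%E.
Proof.
move=> mf f0 nuE mg g0.
have mid : measurable_fun setT (idfun : R -> measurableTypeR R).
  by move=> _ Y mY; rewrite setTI.
have := @ge0_integral_pushforward _ _ R (measurableTypeR R) R idfun mid nu setT g
  measurableT mg (fun y _ => g0 y).
rewrite preimage_setT /= => <-.
exact: ge0_integral_density.
Qed.

Section exponential_noise.
Context {R : realType}.
Local Open Scope ereal_scope.
Variable b : R.
Hypothesis b0 : (0 < b)%R.

Lemma gamma_pdf_ge0 k x : (0 <= gamma_pdf k b x)%R.
Proof.
rewrite /gamma_pdf; have [x0|x0] := leP x 0%R; first exact: lexx.
by rewrite divr_ge0 ?mulr_ge0 ?exprn_ge0 ?expR_ge0 ?ler0n// ltW.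
Qed.

Lemma measurable_gamma_pdf k : measurable_fun setT (gamma_pdf k b).
Proof.
apply: measurable_fun_ifT => //.
  by apply: measurable_fun_ler.
apply: measurable_funM => //.
apply: measurable_funM; first exact: measurable_funX.
apply: measurableT_comp => //.
by apply: measurable_funM => //; exact: measurable_oppr.
Qed.

Lemma gamma_pdf1E (x : R) : x != 0%R -> gamma_pdf 1 b x = exponential_pdf b^-1 x.
Proof.
move=> x0; rewrite /gamma_pdf /exponential_pdf patchE.
case: ifPn => xle.
  rewrite ifF//; apply/negP; rewrite inE /= in_itv/= andbT => x0'.
  by move/negP: x0; apply; rewrite eq_le xle.
rewrite ifT; last by rewrite inE/= in_itv/= andbT ltW// ltNge.
rewrite expr0 mul1r mul1r expr1 mulrC; congr (_ * expR _)%R.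
by rewrite mulNr mulNr mulrC.
Qed.

Lemma gamma1_law :
  {E : probability R R | forall A, measurable A ->
    E A = \int[lebesgue_measure]_(x in A) (gamma_pdf 1 b x)%:E}.
Proof.
have mg : measurable_fun setT (EFin \o gamma_pdf 1 b).
  by apply/measurable_EFinP; exact: measurable_gamma_pdf.
have bV0 : (0 < b^-1)%R by rewrite invr_gt0.
have mid : measurable_fun setT (idfun : measurableTypeR R -> R).
  by move=> _ Y mY; rewrite setTI.
pose I : {mfun measurableTypeR R >-> R} :=
  HB.pack (idfun : measurableTypeR R -> R) (isMeasurableFun.Build _ _ _ _ _ mid).
have [Q QE] : {Q : probability (measurableTypeR R) R |
    forall A, Q A = exponential_prob b^-1 A}.
  by unshelve refine (exist _ (exponential_prob b^-1 : probability (measurableTypeR R) R) _).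
(* Transport along the identity moves the exponential law from [measurableTypeR R] to [R]. *)
exists (distribution Q I) => A mA.
rewrite -[LHS]/(Q A) QE /exponential_prob.
rewrite [LHS]integral_mkcond [RHS]integral_mkcond.
apply: (@eq_integral_off1 _ 0%R) => [| |x x0].
- apply/(measurable_restrictT _ mA); apply/measurable_funTS/measurable_EFinP.
  exact: measurable_exponential_pdf.
- by apply/(measurable_restrictT _ mA); exact: measurable_funTS.
- by rewrite !patchE gamma_pdf1E.
Qed.

(** Substitution x = y + e / (s b): an exponential step of rate s is rescaled noise of mean b. The
    conjunct [mu < x] is the open support of [fexp]; since mu <= y it removes at most the point x =
    y. *)
Lemma ge0_integral_gamma1_affine (E : probability R R) (s mu y : R) (h : R -> \bar R) :
  (forall A, measurable A -> E A = \int[lebesgue_measure]_(x in A) (gamma_pdf 1 b x)%:E) ->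
  (0 < s)%R -> (mu <= y)%R -> measurable_fun setT h -> (forall x, 0 <= h x) ->
  \int[lebesgue_measure]_x
    ((if (mu < x)%R && (y <= x)%R then s * expR (- s * (x - y)) else 0)%:E * h x) =
  \int[E]_e h (y + (s * b)^-1 * e)%R.
Proof.
move=> EE s0 muy mh h0.
set c := ((s * b)^-1)%R; have c0 : (0 < c)%R by rewrite invr_gt0 mulr_gt0.
have maff : measurable_fun setT (fun e : R => y + c * e)%R.
  by apply: measurable_funD => //; exact: measurable_funM.
have mhc : measurable_fun setT (fun e => h (y + c * e)%R) by exact: measurableT_comp.
rewrite (ge0_integral_density_lebesgue (measurable_gamma_pdf 1) (gamma_pdf_ge0 1) EE)//.
pose F (x : R) := if (mu < x)%R && (y <= x)%R then (s * expR (- s * (x - y)))%R else 0%R.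
have mF : measurable_fun setT F.
  apply: measurable_fun_ifT => //.
    apply: measurable_and; first exact: measurable_fun_ltr.
    exact: measurable_fun_ler.
  apply: measurable_funM => //; apply: measurableT_comp => //.
  by apply: measurable_funM => //; exact: measurable_funB.
have F0 x : (0 <= F x)%R.
  by rewrite /F; case: ifP => // _; rewrite mulr_ge0 ?expR_ge0// ltW.
have mFh : measurable_fun setT (fun x => (F x)%:E * h x).
  by apply: emeasurable_funM => //; exact/measurable_EFinP.
rewrite (ge0_integral_affine y c0 mFh); last first.
  by move=> x; rewrite mule_ge0// lee_fin.
rewrite -ge0_integralZl_EFin ?(ltW c0)//; last 2 first.
- by move=> x _; rewrite mule_ge0// lee_fin.
- exact: (measurableT_comp mFh maff).
apply: (@eq_integral_off1 _ 0%R) => [| |x x0].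
- apply: emeasurable_funM => //; exact: (measurableT_comp mFh maff).
- by apply: emeasurable_funM => //; apply/measurable_EFinP; exact: measurable_gamma_pdf.
rewrite muleA -EFinM muleC; congr (_ * _%:E).
rewrite /F /gamma_pdf.
have [xle|xgt] := leP x 0%R.
  rewrite [X in if X then _ else _](_ : _ = false) ?mulr0//.
  apply/negbTE; rewrite negb_and orbC lerDl -ltNge pmulr_rlt0//.
  by rewrite lt_neqAle x0 xle.
have cx : (0 < c * x)%R by rewrite mulr_gt0.
rewrite (le_lt_trans muy) ?ltrDl//= lerDl (ltW cx).
rewrite expr0 mul1r fact0 mul1r expr1 mulrA [RHS]mulrC; congr (_ * expR _)%R.
  by rewrite /c; field; rewrite !gt_eqF.
by rewrite /c; field; rewrite !gt_eqF.
Qed.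

End exponential_noise.

(** * The joint density as a random walk *)

Section joint_density.
Context {R : realType}.
Local Open Scope ereal_scope.
Variables (b mu sigma : R) (E : probability R R) (m : nat) (Rs : nat -> nat).
Hypotheses (b0 : (0 < b)%R) (sigma0 : (0 < sigma)%R).
Hypothesis EE : forall A, measurable A ->
  E A = \int[lebesgue_measure]_(x in A) (gamma_pdf 1 b x)%:E.

Lemma gamS j : (j < m)%N -> gam m Rs j = ((Rs j).+1 + gam m Rs j.+1)%N.
Proof. by move=> jm; rewrite /gam big_ltn. Qed.

Lemma gam_gt0 j : (j < m)%N -> (0 < gam m Rs j)%N.
Proof. by move=> jm; rewrite gamS. Qed.

Lemma iint_eq0 k (g : seq R -> \bar R) : (forall s, g s = 0) -> iint k g = 0.
Proof.
elim: k g => [|k IH] g g0 /=; first exact: g0.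
by apply: integral0_eq => x _; rewrite IH.
Qed.

(** Turns noise of rate 1 / b into a spacing of rate gamma_j / sigma. *)
Definition noise_scale (j : nat) : R := (((gam m Rs j)%:R / sigma) * b)^-1.

(** Keeping the previous value y explicit turns sortedness into a [path] condition, which splits off
    one variable at a time. *)
Definition tail_density (a : nat -> R) (k j : nat) (y : R) (s : seq R) : R :=
  ((if [forall i : 'I_k, nth 0 s i <= a (j + i)%N] then 1 else 0) *
   (if path <=%R y s then 1 else 0) *
   \prod_(i < k) ((gam m Rs (j + i))%:R * fexp mu sigma (nth 0 s i)
                   * (1 - Fexp mu sigma (nth 0 s i)) ^+ Rs (j + i)%N))%R.

Lemma tail_density_cons a k j y x s :
  tail_density a k.+1 j y (x :: s) =
  (((\1_(`]-oo, a j]%classic) x * (if y <= x then 1 else 0)) *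
    ((gam m Rs j)%:R * fexp mu sigma x * (1 - Fexp mu sigma x) ^+ Rs j)) *
  tail_density a k j.+1 x s)%R.
Proof.
rewrite /tail_density big_ord_recl /= addn0.
under eq_bigr do rewrite addnS -addSn.
have -> : ([forall i : 'I_k.+1, nth 0 (x :: s) i <= a (j + i)%N] =
    (x <= a j) && [forall i : 'I_k, nth 0 s i <= a (j.+1 + i)%N])%R.
  apply/forallP/andP => [H|[H1 /forallP H2] i].
    split; first by have := H ord0; rewrite addn0.
    by apply/forallP => i; have := H (lift ord0 i); rewrite lift0 /= addnS.
  have [i'|] := unliftP ord0 i; last by move=> ->; rewrite addn0.
  by move=> ->; rewrite lift0 /= addnS; exact: H2.
rewrite indicE mem_setE in_itv /=.
by case: (x <= a j)%R; case: (y <= x)%R; case: [forall _, _]; case: (path _ _ _);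
  rewrite /= ?mul1r ?mul0r ?mulr0 ?mul0r ?mulr1.
Qed.

(** Used with k = R_j and r = gamma_(j+1): the exponent becomes gamma_j, so the survival factor left
    by the later integrals is absorbed. *)
Lemma hazard_rate (k : nat) (r x : R) : (mu < x)%R ->
  (fexp mu sigma x * (1 - Fexp mu sigma x) ^+ k * expR (- r / sigma * (x - mu)) =
   sigma^-1 * expR (- (k.+1%:R + r) / sigma * (x - mu)))%R.
Proof.
move=> mux; rewrite /fexp /Fexp leNgt mux /=.
rewrite subKr -expRM_natl -!mulrA -!expRD.
set u := (_ - mu)%R.
by congr (_ * expR _)%R; rewrite -natr1; field; rewrite gt_eqF.
Qed.

(** The constant [cst] accumulates the factors of the variables already fixed; without it the
    induction would not go under the integral sign. *)
Lemma iint_tail_density a k j y (cst : R) : (j + k = m)%N -> (mu <= y)%R ->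
  (0 <= cst)%R ->
  iint k (fun s => (cst * tail_density a k j y s)%:E) =
  (cst * expR (- (gam m Rs j)%:R / sigma * (y - mu)))%:E *
  walk_le E noise_scale a k j y.
Proof.
elim: k j y cst => [|k IH] j y cst jkm muy cst0.
  have -> : gam m Rs j = 0%N by rewrite -jkm addn0 /gam big_geq.
  rewrite /= /tail_density big_ord0 oppr0 !mul0r expR0 !mulr1.
  rewrite [X in if X then _ else _](_ : _ = true); last by apply/forallP => -[].
  by rewrite mule1 mulr1.
have jm : (j < m)%N by rewrite -jkm addnS ltnS leq_addr.
have gj : (0 < (gam m Rs j)%:R / sigma)%R by rewrite divr_gt0// ltr0n gam_gt0.
set g := ((gam m Rs j)%:R / sigma)%R in gj *.
rewrite [LHS]/=.
pose h x := (\1_(`]-oo, a j]%classic) x)%:E * walk_le E noise_scale a k j.+1 x.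
have mh : measurable_fun setT h.
  apply: emeasurable_funM; last exact: measurable_walk_le.
  by apply/measurable_EFinP; exact: measurable_indic.
have h0 x : 0 <= h x by rewrite mule_ge0 ?lee_fin ?walk_le_ge0.
transitivity (\int[lebesgue_measure]_x
   ((cst * expR (- (gam m Rs j)%:R / sigma * (y - mu)))%:E *
   ((if (mu < x)%R && (y <= x)%R then g * expR (- g * (x - y)) else 0)%:E * h x))).
  apply: eq_integral => x _.
  under eq_fun do rewrite tail_density_cons mulrA.
  have [mux|xmu] := ltP mu x; last first.
    rewrite mul0e mule0 iint_eq0// => s.
    by rewrite /fexp xmu !(mulr0, mul0r).
  rewrite IH ?addSnnS ?(ltW mux)//; last first.
    rewrite mulr_ge0// mulr_ge0//; first by rewrite mulr_ge0//; case: ifP.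
    rewrite mulr_ge0// ?mulr_ge0// ?exprn_ge0//.
      by rewrite /fexp; case: ifP => // _; rewrite mulr_ge0 ?expR_ge0 ?invr_ge0 ?ltW.
    by rewrite /Fexp ifF ?subKr ?expR_ge0//; apply/negbTE; rewrite -ltNge.
  rewrite /h !muleA -!EFinM; congr (_%:E * _).
  rewrite /=; case: ifPn => yx; last by rewrite !(mulr0, mul0r).
  rewrite mulr1.
  transitivity (cst * \1_(`]-oo, a j]%classic) x * (gam m Rs j)%:R *
     (fexp mu sigma x * (1 - Fexp mu sigma x) ^+ Rs j *
      expR (- (gam m Rs j.+1)%:R / sigma * (x - mu))))%R; first ring.
  rewrite hazard_rate// /g gamS// natrD.
  (* Split x - mu = (y - mu) + (x - y): the first part is the claimed factor, the second the
     exponential density of the increment. *)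
  rewrite [X in (_ * (_ * expR X) = _)%R](_ : _ =
     - ((Rs j).+1%:R + (gam m Rs j.+1)%:R) / sigma * (y - mu) +
     - (((Rs j).+1%:R + (gam m Rs j.+1)%:R) / sigma) * (x - y))%R; last ring.
  by rewrite expRD; ring.
rewrite ge0_integralZl_EFin//; last 3 first.
- by move=> x _; rewrite mule_ge0// lee_fin; case: ifP => // _;
    rewrite mulr_ge0 ?expR_ge0// ltW.
- apply: emeasurable_funM => //; apply/measurable_EFinP.
  apply: measurable_fun_ifT => //.
    apply: measurable_and; first exact: measurable_fun_ltr.
    exact: measurable_fun_ler.
  apply: measurable_funM => //; apply: measurableT_comp => //.
  by apply: measurable_funM => //; exact: measurable_funB.
- by rewrite mulr_ge0 ?expR_ge0.
by rewrite (ge0_integral_gamma1_affine b0 EE).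
Qed.

(** For k > 0 the integrand is only evaluated on nonempty lists, where [sorted] unfolds to
    [path]. *)
Lemma iint_cons_ext k (g g' : seq R -> \bar R) : (0 < k)%N ->
  (forall x s, g (x :: s) = g' (x :: s)) -> iint k g = iint k g'.
Proof.
case: k => // k _ gg' /=; apply: eq_integral => x _.
by congr iint; apply/funext => s.
Qed.

Lemma iint_pcos_density (a : nat -> R) : (0 < m)%N ->
  iint m (fun s => ((if [forall j : 'I_m, (nth 0 s j <= a j)%R] then 1 else 0)
                      * pcos_density m Rs mu sigma s)%:E) =
  walk_le E noise_scale a m 0 mu.
Proof.
move=> m0; have := @iint_tail_density a m 0 mu 1 (add0n _) (lexx _) ler01.
rewrite subrr mulr0 expR0 mul1r mul1e => <-.
apply: iint_cons_ext => // x s; rewrite mul1r; congr EFin.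
rewrite /tail_density /pcos_density -mulrA; congr (_ * _)%R.
(* [pcos_density] does not ask for mu <= x, unlike the path from mu; for x < mu both sides vanish
   through [fexp]. *)
have [mux|xmu] := leP mu x.
  by rewrite /= mux; case: (path _ _ _); rewrite ?mul1r ?mul0r.
rewrite [X in (_ = _ * X)%R](bigD1 (Ordinal m0))//= {2}/fexp (ltW xmu) mulr0 !mul0r mulr0.
case: (path _ _ _) => //.
by rewrite (bigD1 (Ordinal m0))//= {1}/fexp (ltW xmu) mulr0 !mul0r.
Qed.

End joint_density.

(** * Gamma laws as convolutions *)

Lemma integral_subX (R : realType) (u : R) k : 0 < u ->
  (\int[lebesgue_measure]_(e in `[0%R, u]) ((u - e) ^+ k)%:E = (u ^+ k.+1 / k.+1%:R)%:E)%E.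
Proof.
move=> u0; pose F (e : R) := - ((u - e) ^+ k.+1 / k.+1%:R).
have dF (x : R) : is_derive x (1 : R) F ((u - x) ^+ k).
  have -> : F = - ((k.+1%:R^-1 : R) *: ((cst u - id) ^+ k.+1 : R -> R)).
    by apply/funext => e; rewrite /F mulrC !fctE.
  apply: is_derive_eq; rewrite /GRing.scale /=.
  by rewrite sub0r !mulrN mulr1 opprK mulrnAl -mulrnAr -mulr_natl; field.
have FTC : (\int[lebesgue_measure]_(e in `[0%R, u]) ((u - e) ^+ k)%:E =
    (F u)%:E - (F 0)%:E)%E; last first.
  rewrite FTC -EFinB; congr EFin.
  by rewrite /F subrr expr0n /= mul0r oppr0 addr0 sub0r opprK.
apply: continuous_FTC2 => //.
- apply: continuous_subspaceT => x.
  apply: (@continuous_comp _ _ _ (fun e : R => u - e) (fun y : R => y ^+ k)).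
    by apply: continuousB => //; exact: cst_continuous.
  exact: exprn_continuous.
- have cF x : {for x, continuous F}.
    by apply/differentiable_continuous/derivable1_diffP; exact: ex_derive.
  split; first by move=> x _; exact: ex_derive.
  - by apply: cvg_at_right_filter; exact: cF.
  - by apply: cvg_at_left_filter; exact: cF.
- by move=> x _; rewrite derive1E; exact: derive_val.
Qed.

Section gamma_law.
Context {R : realType}.
Local Open Scope ereal_scope.
Variables (b : R) (E : probability R R).
Hypothesis b0 : (0 < b)%R.
Hypothesis EE : forall A, measurable A ->
  E A = \int[lebesgue_measure]_(x in A) (gamma_pdf 1 b x)%:E.

(** The exponentials combine to exp(-u / b), which does not involve e; what remains is the integral
    of (u - e)^k over [0, u]. *)
Lemma gamma_pdf_convolution k (u : R) :
  \int[lebesgue_measure]_e ((gamma_pdf k.+1 b (u - e))%:E * (gamma_pdf 1 b e)%:E) =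
  (gamma_pdf k.+2 b u)%:E.
Proof.
have [u0|u0] := leP u 0%R.
  rewrite [in RHS]/gamma_pdf u0 integral0_eq// => e _; rewrite -EFinM; congr EFin.
  rewrite /gamma_pdf; have [e0|e0] := leP e 0%R; first by rewrite mulr0.
  by rewrite ifT ?mul0r// subr_le0 (le_trans u0)// ltW.
pose C := (expR (- u / b) / (k`!%:R * b ^+ k.+2))%R.
have C0 : (0 <= C)%R.
  by rewrite divr_ge0 ?expR_ge0// mulr_ge0 ?ler0n// exprn_ge0// ltW.
have mX : measurable_fun setT (fun e : R => ((u - e) ^+ k)%:E : \bar R).
  by apply/measurable_EFinP/measurable_funX; exact: measurable_funB.
transitivity (\int[lebesgue_measure]_(e in `]0%R, u[) (C%:E * ((u - e) ^+ k)%:E)).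
  rewrite [RHS]integral_mkcond; apply: eq_integral => e _.
  rewrite patchE mem_setE in_itv /= -!EFinM /gamma_pdf.
  have [e0|e0] /= := leP e 0%R; first by rewrite mulr0.
  rewrite subr_le0; have [ue|ue] /= := leP u e; first by rewrite mul0r.
  congr EFin; rewrite expr0 mul1r mul1r /C expr1.
  rewrite (_ : - u / b = - (u - e) / b + - e / b)%R; last by field; rewrite gt_eqF.
  rewrite expRD (exprSr b k.+1).
  set q := (b ^+ k.+1)%R; have q0 : (0 < q)%R by rewrite exprn_gt0.
  by field; rewrite !gt_eqF// ltr0n fact_gt0.
rewrite -(@integral_itv_bndoo _ _ _ _ true false); last first.
  by apply/measurable_funTS/emeasurable_funM => //; exact: measurable_cst.
rewrite ge0_integralZl_EFin//; last 2 first.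
- by move=> e; rewrite /= in_itv/= => /andP[_ eu]; rewrite lee_fin exprn_ge0// subr_ge0.
- exact: measurable_funTS.
rewrite integral_subX// -EFinM; congr EFin.
rewrite /gamma_pdf leNgt u0 /= /C factS natrM; field.
by rewrite !gt_eqF// ?exprn_gt0// ltr0n// fact_gt0.
Qed.

(** The Dirac mass is the law of the empty sum, present when only the first observation has been
    read. *)
Definition gamma_law (k : nat) (B : set R) : \bar R :=
  if k is k'.+1 then \int[lebesgue_measure]_(x in B) (gamma_pdf k b x)%:E
  else \d_(0%R : R) B.

Lemma gamma_lawS k (B : set R) : measurable B ->
  gamma_law k.+1 B = \int[E]_e gamma_law k [set v | B (v + e)%R].
Proof.
move=> mB.
have memB v e : (v \in [set v | B (v + e)%R]) = ((v + e)%R \in B).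
  by apply/idP/idP; rewrite !inE.
case: k => [|k].
  rewrite /= -EE// -[in LHS](setIT B) -integral_indic//.
  by apply: eq_integral => e _; rewrite diracE indicE memB add0r.
have mg j : measurable_fun setT (fun x => (gamma_pdf j b x)%:E : \bar R).
  by apply/measurable_EFinP; exact: measurable_gamma_pdf.
have g0 j x : 0 <= (gamma_pdf j b x)%:E by rewrite lee_fin gamma_pdf_ge0.
pose h (ue : measurableTypeR R * measurableTypeR R) : \bar R :=
  (\1_B ue.1)%:E * (gamma_pdf k.+1 b (ue.1 - ue.2))%:E.
have h0 ue : 0 <= h ue by rewrite mule_ge0// lee_fin.
have mh : measurable_fun setT h.
  apply: emeasurable_funM.
    apply: (measurableT_comp (f := fun x => (\1_B x)%:E)) => //.
    by apply/measurable_EFinP; exact: measurable_indic.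
  by apply: (measurableT_comp (mg k.+1)); exact: measurable_funB.
pose f (ue : measurableTypeR R * measurableTypeR R) : \bar R :=
  h ue * (gamma_pdf 1 b ue.2)%:E.
have f0 ue : 0 <= f ue by rewrite mule_ge0.
have mf : measurable_fun setT f.
  by apply: emeasurable_funM => //; exact: (measurableT_comp (mg 1%N)).
have inner e : gamma_law k.+1 [set v | B (v + e)%R] =
   \int[lebesgue_measure]_u h (u, e).
  rewrite /= integral_mkcond.
  have maf : measurable_fun setT (fun v : R => v + e)%R by exact: measurable_funD.
  (* Translation u = v + e, so that the order of integration can be exchanged with the set B
     fixed. *)
  have := @ge0_integral_affine R (- e) 1
    (fun v => (\1_B (v + e)%R)%:E * (gamma_pdf k.+1 b v)%:E) ltr01.
  rewrite mul1e => {}H; transitivity (\int[lebesgue_measure]_v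
    ((\1_B (v + e)%R)%:E * (gamma_pdf k.+1 b v)%:E)).
    apply: eq_integral => v _; rewrite patchE indicE memB.
    by case: (_ \in _); rewrite ?mul1e ?mul0e.
  rewrite H.
  - by apply: eq_integral => u _; rewrite mul1r (addrC (- e)%R) subrK.
  - apply: emeasurable_funM => //; apply/measurable_EFinP.
    by apply: (measurableT_comp _ maf); exact: measurable_indic.
  - by move=> v; rewrite mule_ge0// lee_fin.
under [RHS]eq_integral do rewrite inner.
rewrite (ge0_integral_density_lebesgue (measurable_gamma_pdf b 1)
  (gamma_pdf_ge0 b0 1) EE); last 2 first.
- exact: (measurable_fun_fubini_tonelli_G h mh h0).
- by move=> e; exact: integral_ge0.
transitivity (\int[lebesgue_measure]_e \int[lebesgue_measure]_u f (u, e)); last first.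
  apply: eq_integral => e _; rewrite muleC -ge0_integralZl_EFin//.
  - by apply: eq_integral => u _; rewrite muleC.
  - exact: (measurableT_comp mh).
  - by rewrite -lee_fin.
rewrite -(fubini_tonelli f mf f0) /=.
rewrite integral_mkcond; apply: eq_integral => u _; rewrite patchE /f /h /=.
rewrite indicE; case: (u \in B); last first.
  by rewrite integral0_eq// => e _; rewrite !mul0e.
under eq_integral do rewrite mul1e.
by rewrite gamma_pdf_convolution.
Qed.

End gamma_law.

(** * Joint law of the spacings *)

Lemma gamma_law_ge0 (R : realType) (b : R) k B : 0 < b -> (0 <= gamma_law b k B)%E.
Proof.
move=> b0; case: k => [|k] /=; first exact: measure_ge0.
by apply: integral_ge0 => x _; rewrite lee_fin gamma_pdf_ge0.
Qed.

Section spacing_law.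
Context {R : realType}.
Local Open Scope ereal_scope.
Variables (b mu sigma : R) (E : probability R R) (m : nat) (Rs : nat -> nat).
Hypotheses (b0 : (0 < b)%R) (sigma0 : (0 < sigma)%R).
Hypothesis EE : forall A, measurable A ->
  E A = \int[lebesgue_measure]_(x in A) (gamma_pdf 1 b x)%:E.

Lemma noise_Nyitv (t : R) :
  E `]-oo, t]%classic = (if (t <= 0)%R then 0%R else (1 - expR (- t / b))%R)%:E.
Proof.
rewrite EE//; case: leP => t0.
  rewrite integral0_eq// => x; rewrite /= in_itv/= => xt.
  by rewrite /gamma_pdf (le_trans xt).
have := @exponential_prob_itv0c R b^-1 t t0.
rewrite -EFinB mulrC mulrN -mulNr => <-.
rewrite /exponential_prob [LHS]integral_mkcond [RHS]integral_mkcond.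
apply: (@eq_integral_off1 _ 0%R) => [| |x x0].
- apply/(measurable_restrictT _ _).1 => //; apply/measurable_funTS/measurable_EFinP.
  exact: measurable_gamma_pdf.
- apply/(measurable_restrictT _ _).1 => //; apply/measurable_funTS/measurable_EFinP.
  exact: measurable_exponential_pdf.
rewrite !patchE !mem_setE !in_itv /= -gamma_pdf1E//.
have [xle|xgt] /= := leP 0%R x; first by [].
by rewrite /gamma_pdf (ltW xgt); case: ifP.
Qed.

Let s := noise_scale b sigma m Rs.

(* ((X_0, b / sigma * sum of the scaled spacings), last observation) *)
Definition spacing_upd (j : nat) (zx : (R * R) * R * R) : (R * R) * R :=
  (if j == 0%N then (zx.2, 0%R)
   else (zx.1.1.1, (zx.1.1.2 + (s j)^-1 * (zx.2 - zx.1.2))%R), zx.2).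

Lemma measurable_spacing_upd j : measurable_fun setT (spacing_upd j).
Proof.
have m2 : measurable_fun setT (fun zx : (R * R) * R * R => zx.2) by exact: measurable_snd.
have m1 : measurable_fun setT (fun zx : (R * R) * R * R => zx.1) by exact: measurable_fst.
have m12 : measurable_fun setT (fun zx : (R * R) * R * R => zx.1.2).
  exact: (measurableT_comp measurable_snd m1).
have m11 : measurable_fun setT (fun zx : (R * R) * R * R => zx.1.1).
  exact: (measurableT_comp measurable_fst m1).
apply: measurable_fun_pair => //; case: eqP => _.
  by apply: measurable_fun_pair.
apply: measurable_fun_pair; first exact: (measurableT_comp measurable_fst m11).
apply: measurable_funD; first exact: (measurableT_comp measurable_snd m11).
by apply: measurable_funM => //; exact: measurable_funB.
Qed.

(** The walk starts at mu; the two zeros are placeholders overwritten by the update at j = 0. *)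
Let z0 : (R * R) * R := ((0%R, 0%R), mu).
Let mcur : measurable_fun setT (snd : (R * R) * R -> R) := measurable_snd.
Let cur_upd j zx : snd (spacing_upd j zx) = zx.2.
Proof. by []. Qed.

Definition spacing_law (j : nat) : probability ((R * R) * R)%type R :=
  state_law E s z0 mcur measurable_spacing_upd j.

Lemma spacing_law_rect j (A B : set R) : (j < m)%N -> measurable A -> measurable B ->
  spacing_law j.+1 [set z | A z.1.1 /\ B z.1.2] =
  E [set e | A (mu + s 0%N * e)%R] * gamma_law b j B.
Proof.
have mfst : measurable_fun setT (fun z : (R * R) * R => z.1.1).
  exact: (measurableT_comp measurable_fst measurable_fst).
have msnd : measurable_fun setT (fun z : (R * R) * R => z.1.2).
  exact: (measurableT_comp measurable_snd measurable_fst).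
have mR (C D : set R) : measurable C -> measurable D ->
    measurable [set z : (R * R) * R | C z.1.1 /\ D z.1.2].
  move=> mC mD; apply: measurableI.
    by rewrite -[X in measurable X]setTI; exact: mfst.
  by rewrite -[X in measurable X]setTI; exact: msnd.
elim: j A B => [|j IH] A B jm mA mB; rewrite /spacing_law state_lawS.
  set D := _ @^-1` _.
  have mD : measurable D.
    rewrite -[X in measurable X]setTI.
    by apply: (measurable_step s mcur measurable_spacing_upd) => //; exact: mR.
  transitivity (\int[\d_z0]_z E (xsection D z)); first by [].
  rewrite integral_dirac//; last exact: measurable_fun_xsection.
  rewrite diracT mul1e /= diracE.
  have xD : xsection D z0 = [set e | A (mu + s 0%N * e)%R /\ B 0%R].
    by apply/seteqP; split=> e; rewrite /xsection /= inE.
  rewrite xD; case: (boolP (0%R \in B)) => B0 /=.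
    rewrite mule1; congr (E _); apply/seteqP; split => e /=; first by case.
    by move=> Ae; split => //; exact: set_mem.
  rewrite mule0 -(measure0 E); congr (E _); apply/seteqP; split => e //= -[_ /mem_set].
  by rewrite (negbTE B0).
pose D (C : set R) := step s snd spacing_upd j.+1 @^-1` [set z | C z.1.1 /\ B z.1.2].
have mD C : measurable C -> measurable (D C).
  move=> mC; rewrite -[X in measurable X]setTI.
  by apply: (measurable_step s mcur measurable_spacing_upd) => //; exact: mR.
have sj0 : (s j.+1 != 0)%R.
  by rewrite /s /noise_scale invr_eq0 gt_eqF// mulr_gt0// divr_gt0// ltr0n gam_gt0.
(* Rescaling the increment s_j e by 1 / s_j returns the noise e, so the running sum grows by exactly
   e. *)
have ysD C e : ysection (D C) e = [set z | C z.1.1 /\ [set v | B (v + e)%R] z.1.2].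
  apply/seteqP; split=> z; rewrite /ysection /= inE /D /= /step /spacing_upd /=;
    by rewrite addrAC subrr add0r mulKf.
have mBe e : measurable [set v | B (v + e)%R].
  have maf : measurable_fun setT (fun v : R => v + e)%R by exact: measurable_funD.
  by rewrite -[X in measurable X]setTI; exact: maf.
rewrite -[LHS]/((spacing_law j.+1 \x E) (D A)).
have mDA := mD A mA; have mDT := mD setT measurableT.
have -> : (spacing_law j.+1 \x E) (D A) = \int[E]_e spacing_law j.+1 (ysection (D A) e).
  have m1D : measurable_fun setT (fun ze => (\1_(D A) ze)%:E : \bar R).
    by apply/measurable_EFinP; exact: measurable_indic.
  rewrite -[X in _ X = _](setIT (D A)) -integral_indic// fubini_tonelli2//.
  apply: eq_integral => e _; rewrite /fubini_G.
  transitivity (spacing_law j.+1 (ysection (D A) e `&` setT)); last by rewrite setIT.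
  rewrite -integral_indic//; last exact: measurable_ysection.
  apply: eq_integral => z _; rewrite !indicE; congr ((_ : bool)%:R%:E).
  by rewrite mem_ysection.
have gE C e : measurable C -> spacing_law j.+1 (ysection (D C) e) =
    E [set e' | C (mu + s 0%N * e')%R] * gamma_law b j [set v | B (v + e)%R].
  by move=> mC; rewrite ysD IH// ltnW.
(* Measurability in e comes from the induction hypothesis with C the whole line: the function is
   then the measure of a section. *)
have mg : measurable_fun setT (fun e : R => gamma_law b j [set v | B (v + e)%R]).
  apply: (eq_measurable_fun (fun e : R => spacing_law j.+1 (ysection (D setT) e))).
    by move=> e _; rewrite gE// -[X in X * _]/(E setT) probability_setT mul1e.
  exact: (measurable_fun_ysection (spacing_law j.+1) mDT).
under eq_integral do rewrite gE//.
rewrite (gamma_lawS b0 EE)//.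
have mAe : measurable [set e' | A (mu + s 0%N * e')%R].
  have maf : measurable_fun setT (fun v : R => mu + s 0%N * v)%R.
    by apply: measurable_funD => //; exact: measurable_funM.
  by rewrite -[X in measurable X]setTI; exact: maf.
set a := E _; have -> : a = (fine a)%:E by rewrite fineK// fin_num_measure.
rewrite ge0_integralZl_EFin//.
- by move=> e _; exact: gamma_law_ge0.
- exact/fine_ge0/measure_ge0.
Qed.

Context d (Omega : measurableType d) (P : probability Omega R) (X : nat -> Omega -> R).

Definition spacing_sum (j : nat) (w : Omega) : R :=
  (\sum_(1 <= i < j.+1) (s i)^-1 * (X i w - X i.-1 w))%R.

Lemma state_spacing j w :
  state X z0 spacing_upd j.+1 w = ((X 0%N w, spacing_sum j w), X j w).
Proof.
elim: j => [|j IH]; first by rewrite /= /spacing_upd /= /spacing_sum big_geq.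
rewrite -[LHS]/(spacing_upd j.+1 (state X z0 spacing_upd j.+1 w, X j.+1 w)) IH.
by rewrite /spacing_upd /= /spacing_sum [in RHS]big_nat_recr.
Qed.

Lemma pcos_spacing_law (A B : set R) : (0 < m)%N ->
  is_pcos_sample P m Rs mu sigma X -> measurable A -> measurable B ->
  P (X 0%N @^-1` A `&` spacing_sum m.-1 @^-1` B) =
  E [set e | A (mu + s 0%N * e)%R] * gamma_law b m.-1 B.
Proof.
move=> m0 [mX XE] mA mB.
rewrite -spacing_law_rect ?prednK//.
have walkE (a : nat -> R) :
    P [set w | forall j, (j < m)%N -> (X j w <= a j)%R] = walk_le E s a m 0 (z0.2).
  by rewrite XE; exact: iint_pcos_density.
have mC : measurable [set z : (R * R) * R | A z.1.1 /\ B z.1.2].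
  apply: measurableI.
    rewrite -[X in measurable X]setTI.
    exact: (measurableT_comp measurable_fst measurable_fst).
  rewrite -[X in measurable X]setTI.
  exact: (measurableT_comp measurable_snd measurable_fst).
(* At j = m no observation remains to be bounded, so the thresholds are arbitrary and [walk_le]
   equals 1. *)
have := state_law_rest mX mcur measurable_spacing_upd cur_upd walkE (fun=> 0%R) (leqnn m) mC.
rewrite subnn /= integral_cst// mul1e => <-.
congr (P _); apply/seteqP; split => w /=.
  move=> [Aw Bw]; split; last by move=> i /andP[/leq_ltn_trans H /H]; rewrite ltnn.
  by rewrite -(prednK m0) state_spacing.
by move=> [+ _]; rewrite -[in X in X -> _](prednK m0) state_spacing.
Qed.

End spacing_law.

(** * Kolmogorov distance of two exponential distributions *)

Section kolmogorov_distance.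
Context {R : realType}.
Implicit Types s t x y z : R.

(** The tangent at l x bounds exp from below at x and at 0; averaging with weights l and 1 - l
    cancels the linear terms. *)
Lemma expR_convexl (l x : R) : 0 <= l <= 1 -> expR (l * x) <= l * expR x + (1 - l).
Proof.
move=> /andP[l0 l1].
have e0 : 0 < expR (l * x) := expR_gt0 _.
have h1 : expR (l * x) * (1 + (x - l * x)) <= expR x.
  rewrite -[leRHS](_ : expR (l * x) * expR (x - l * x) = _).
    by rewrite ler_pM2l// expR_ge1Dx.
  by rewrite -expRD subrKC.
have h2 : expR (l * x) * (1 - l * x) <= 1.
  rewrite -[leRHS](_ : expR (l * x) * expR (- (l * x)) = _).
    by rewrite ler_pM2l// expR_ge1Dx.
  by rewrite -expRD subrr expR0.
have h3 : l * (expR (l * x) * (1 + (x - l * x))) <= l * expR x by exact: ler_wpM2l.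
have h4 : (1 - l) * (expR (l * x) * (1 - l * x)) <= (1 - l) * 1.
  by apply: ler_wpM2l => //; rewrite subr_ge0.
by move: h3 h4; lra.
Qed.

Definition kolm_U s : R := 1 - expR (- s).
Definition kolm_V s t : R := `|1 - t| * expR ((s - t * ln t) / (t - 1))
  * ((if t < 1 then 1 else 0) + (if s < ln t then 1 else 0)).

(** The positive part replaces the case split, exhibiting [Fexp] as a composite of continuous, hence
    measurable, functions. *)
Lemma FexpE (mu sigma x : R) :
  Fexp mu sigma x = 1 - expR (- Num.max (x - mu) 0 / sigma).
Proof.
rewrite /Fexp; case: ifPn => [xmu|].
  by rewrite max_r ?subr_le0// oppr0 mul0r expR0 subrr.
by rewrite -ltNge => mux; rewrite max_l// subr_ge0 ltW.
Qed.

Lemma Fexp_standard (mu sigma s t z : R) : 0 < sigma ->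
  Fexp (mu + sigma * s) (sigma * t) (mu + sigma * z) = Fexp s t z.
Proof.
move=> s0; rewrite /Fexp lerD2l ler_pM2l//; case: ifP => // _.
congr (1 - expR _); rewrite (_ : - _ = sigma * - (z - s)); last by ring.
by rewrite invfM mulrACA divff ?gt_eqF// mul1r.
Qed.

Definition kolm_dist s t : R := sup (range (fun z => `|Fexp s t z - Fexp 0 1 z|)).

Lemma kolm_dist_standard (mu sigma s t : R) : 0 < sigma ->
  sup (range (fun x => `|Fexp (mu + sigma * s) (sigma * t) x - Fexp mu sigma x|)) =
  kolm_dist s t.
Proof.
move=> s0; congr sup; apply/seteqP; split => _ [z _ <-].
  exists ((z - mu) / sigma) => //.
  rewrite -(Fexp_standard mu s t _ s0) -(Fexp_standard mu 0 1 _ s0) mulr0 addr0 mulr1.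
  by rewrite (_ : mu + sigma * ((z - mu) / sigma) = z)//; field; rewrite gt_eqF.
exists (mu + sigma * z) => //.
have := Fexp_standard mu 0 1 z s0; rewrite mulr0 addr0 mulr1 => ->.
by rewrite Fexp_standard.
Qed.

Section bound.
Variables s t : R.
Hypotheses (s0 : 0 <= s) (t0 : 0 < t).

Let U0 : 0 <= kolm_U s.
Proof. by rewrite subr_ge0 -expR0 ler_expR oppr_le0. Qed.

(* the maximizer of |F_(s,t) - F_(0,1)| on ]s, +oo[ *)
Let zs := (t * ln t - s) / (t - 1).

(** At z = zs this reads t^-1 exp(-(zs - s) / t) = exp(-zs): the two densities cross there. *)
Let zsE z : t != 1 -> (z - s) / t = zs - ln t + (z - zs) / t.
Proof. by move=> t1; rewrite /zs; field; rewrite subr_eq0 t1 gt_eqF. Qed.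

(** The indicators never add up to 2: t < 1 forces ln t <= 0 <= s. *)
Let kolm_VE : t != 1 -> (t < 1) || (s < ln t) -> kolm_V s t = `|1 - t| * expR (- zs).
Proof.
move=> t1 st; rewrite /kolm_V [X in _ * X](_ : _ = 1) ?mulr1; last first.
  have [tlt1|tge1] := ltP t 1.
    by rewrite ifF ?addr0//; apply/negbTE; rewrite -leNgt (le_trans _ s0)// ln_le0// ltW.
  by move: st; rewrite ltNge tge1 /= => ->; rewrite add0r.
by congr (_ * expR _); rewrite /zs -[RHS]mulNr opprB.
Qed.

Let tail z : t != 1 ->
  expR (- (z - s) / t) = t * (expR (- zs) * expR (- (z - zs) / t)).
Proof.
move=> t1; transitivity (expR (ln t) * (expR (- zs) * expR (- (z - zs) / t))).
  by rewrite -!expRD mulNr zsE//; congr expR; ring.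
by rewrite lnK ?posrE.
Qed.

Lemma kolm_le z : `|Fexp s t z - Fexp 0 1 z| <= Num.max (kolm_U s) (kolm_V s t).
Proof.
have V0 : 0 <= kolm_V s t.
  by rewrite /kolm_V mulr_ge0 ?mulr_ge0 ?expR_ge0//; case: ifP; case: ifP => //; lra.
rewrite /Fexp; have [zs'|sz] := leP z s.
  rewrite sub0r normrN le_max; apply/orP; left.
  case: ifPn => [_|]; first by rewrite normr0.
  rewrite -ltNge => z0; rewrite divr1 subr0 ger0_norm ?subr_ge0.
    by rewrite lerD2l lerN2 ler_expR lerN2.
  by rewrite -expR0 ler_expR oppr_le0 ltW.
rewrite [z <= 0]leNgt (le_lt_trans s0 sz) /= divr1 subr0.
set A := expR (- z); set B := expR _.
rewrite (_ : 1 - B - (1 - A) = A - B); last by ring.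
have Aez : A = expR (- s) * expR (- (z - s)) by rewrite -expRD; congr expR; ring.
have es1 : expR (- s) <= 1 by rewrite -expR0 ler_expR oppr_le0.
have es0 : 0 < expR (- s) := expR_gt0 _.
have ey0 : 0 < expR (- (z - s)) := expR_gt0 _.
have ey1 : expR (- (z - s)) <= 1 by rewrite -expR0 ler_expR oppr_le0 subr_ge0 ltW.
have [t1|t1|t1] := ltgtP t 1.
- rewrite ler_norml; apply/andP; split.
    rewrite lerNl opprB le_max; apply/orP; left.
    have : B <= expR (- (z - s)).
      rewrite ler_expR mulNr lerN2 ler_pdivlMr// ger_pMr ?subr_gt0//; exact: ltW.
    by rewrite Aez /kolm_U; nra.
  rewrite le_max; apply/orP; right.
  rewrite kolm_VE ?lt_eqF ?t1// /B tail ?lt_eqF//.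
  rewrite (_ : A = expR (- zs) * expR (t * (- (z - zs) / t))); last first.
    by rewrite -expRD; congr expR; field; rewrite gt_eqF.
  (* With d = z - zs this is exp(-d) <= t exp(-d / t) + 1 - t; times exp(-zs) it bounds A - B by
     V. *)
  have := @expR_convexl t (- (z - zs) / t); rewrite (ltW t0) (ltW t1) => /(_ isT).
  rewrite gtr0_norm ?subr_gt0//.
  have := expR_gt0 (- zs); nra.
- have AB : A <= B.
    rewrite ler_expR mulNr lerN2 ler_pdivrMr//.
    have : 0 <= (t - 1) * z by rewrite mulr_ge0 ?subr_ge0 ?(ltW t1)// (le_trans s0)// ltW.
    by move: s0; lra.
  rewrite ler0_norm ?subr_le0// opprB.
  have cvx : forall d, expR (- d / t) <= t^-1 * expR (- d) + (1 - t^-1).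
    move=> d; rewrite mulrC; apply: expR_convexl.
    by rewrite invr_ge0 (ltW t0) invf_le1// ltW.
  have tV0 : 0 < t^-1 by rewrite invr_gt0.
  have ttV : t * t^-1 = 1 by rewrite divff ?gt_eqF.
  (* For t > 1 the crossing point exceeds s only if s < ln t. Otherwise convexity is applied from s
     itself, and exp(-s) <= 1 / t gives the bound U. *)
  rewrite le_max; have [sl|ls] := ltP s (ln t); apply/orP; [right|left].
    rewrite kolm_VE ?gt_eqF ?sl ?orbT// /B tail ?gt_eqF//.
    rewrite (_ : A = expR (- zs) * expR (- (z - zs))); last first.
      by rewrite -expRD; congr expR; ring.
    rewrite ltr0_norm ?subr_lt0//.
    have := cvx (z - zs); have := expR_gt0 (- zs).
    move: (expR (- zs)) (expR (- (z - zs) / t)) (expR (- (z - zs))) => p q r p0 qr.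
    have tq : t * q <= r + t - 1.
      by have := ler_wpM2l (ltW t0) qr; rewrite mulrDr mulrBr mulrA ttV mul1r mulr1; lra.
    by have := ler_wpM2l (ltW p0) tq; lra.
  have etl : expR (- s) <= t^-1.
    by rewrite -[leRHS](_ : expR (- ln t) = _) ?ler_expR ?lerN2// expRN lnK ?posrE.
  have := cvx (z - s); rewrite -/B Aez /kolm_U.
  nra.
- have BA : A <= B.
    by rewrite ler_expR t1 divr1 lerN2 lerBlDr lerDl.
  rewrite ler0_norm ?subr_le0// opprB le_max; apply/orP; left.
  have -> : B = expR (- (z - s)) by rewrite /B t1 divr1.
  by rewrite Aez /kolm_U; nra.
Qed.

Lemma kolm_attained :
  exists z, `|Fexp s t z - Fexp 0 1 z| = Num.max (kolm_U s) (kolm_V s t).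
Proof.
have atU : `|Fexp s t s - Fexp 0 1 s| = kolm_U s.
  rewrite /Fexp lexx sub0r normrN divr1 subr0; case: ifPn => [sle|_].
    by rewrite normr0 /kolm_U (_ : s = 0) ?oppr0 ?expR0 ?subrr//; apply/le_anti/andP.
  by rewrite ger0_norm.
have [|st] := boolP ((t != 1) && ((t < 1) || (s < ln t))); last first.
  exists s; rewrite atU max_l//; move: st; rewrite negb_and negbK negb_or.
  rewrite /kolm_V => /orP[/eqP ->|/andP[/negbTE -> /negbTE ->]].
    by rewrite subrr normr0 !mul0r.
  by rewrite addr0 mulr0.
move=> /andP[t1 st].
have [UV|VU] := leP (kolm_U s) (kolm_V s t); last by exists s.
exists zs; rewrite kolm_VE//.
have szs : s < zs.
  rewrite /zs; move: t1; rewrite neq_lt => /orP[t1|t1].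
    rewrite ltr_ndivlMr ?subr_lt0//.
    have : t * ln t < t * s by rewrite ltr_pM2l// (lt_le_trans _ s0)// ln_lt0// t0.
    lra.
  rewrite ltr_pdivlMr ?subr_gt0//.
  move: st; rewrite ltNge (ltW t1) /= => st.
  have : t * s < t * ln t by rewrite ltr_pM2l.
  lra.
rewrite /Fexp leNgt szs leNgt (le_lt_trans s0 szs) /= divr1 subr0.
rewrite tail// subrr oppr0 mul0r expR0 mulr1.
rewrite (_ : _ - _ = (1 - t) * expR (- zs)); last ring.
by rewrite normrM (ger0_norm (expR_ge0 _)).
Qed.

Lemma kolm_distE : kolm_dist s t = Num.max (kolm_U s) (kolm_V s t).
Proof.
have [z zE] := kolm_attained.
apply/le_anti/andP; split.
  apply: ge_sup; first by exists (`|Fexp s t 0 - Fexp 0 1 0|); exists 0.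
  by move=> _ [x _ <-]; exact: kolm_le.
rewrite -zE; apply: ub_le_sup; last by exists z.
by exists (Num.max (kolm_U s) (kolm_V s t)) => _ [x _ <-]; exact: kolm_le.
Qed.

End bound.
End kolmogorov_distance.

(** * Comparison of laws and quantiles *)

Section laws.
Context {R : realType}.
Local Open Scope ereal_scope.

Lemma measure_off_null d (T : measurableType d) (mu : {measure set T -> \bar R})
    (A B N : set T) : measurable A -> measurable B -> measurable N -> mu N = 0 ->
  (forall w, ~ N w -> A w <-> B w) -> mu A = mu B.
Proof.
move=> mA mB mN N0 AB.
have H C : measurable C -> mu C = mu (C `&` ~` N).
  move=> mC; rewrite -[in LHS](setIT C) -(setUv N) setIUr measureU//.
  - rewrite [X in X + _](_ : _ = 0) ?add0e//.
    apply/eqP; rewrite eq_le measure_ge0 andbT -N0; apply: le_measure; rewrite ?inE//.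
    exact: measurableI.
  - exact: measurableI.
  - by apply: measurableI => //; exact: measurableC.
  - by rewrite setIACA setICr setI0.
rewrite H// [RHS]H//; congr (mu _); apply/seteqP.
by split => w [Aw Nw]; split => //; apply/(AB _ Nw).
Qed.

Lemma eq_pair_law d1 d2 (T1 : measurableType d1) (T2 : measurableType d2)
    (P : probability T1 R) (Q : probability T2 R) (S T : T1 -> R) (S' T' : T2 -> R) :
  measurable_fun setT S -> measurable_fun setT T ->
  measurable_fun setT S' -> measurable_fun setT T' ->
  (forall A B, measurable A -> measurable B ->
     P (S @^-1` A `&` T @^-1` B) = Q (S' @^-1` A `&` T' @^-1` B)) ->
  forall D : set (R * R), measurable D ->
    P [set w | D (S w, T w)] = Q [set w | D (S' w, T' w)].
Proof.
move=> mS mT mS' mT' PQ D mD.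
have [m1 m1E] := image_measure P (measurable_fun_pair mS mT).
have [m2 m2E] := image_measure Q (measurable_fun_pair mS' mT').
rewrite -[LHS]m1E -[RHS]m2E; apply: measure_unique_prod => //.
  by rewrite m1E preimage_setT -[X in X < _]/(P setT) probability_setT ltry.
by move=> A B mA mB; rewrite m1E m2E; exact: PQ.
Qed.

Lemma eq_law_Nyitv d1 d2 (T1 : measurableType d1) (T2 : measurableType d2)
    (P : probability T1 R) (Q : probability T2 R) (S : T1 -> R) (S' : T2 -> R) :
  measurable_fun setT S -> measurable_fun setT S' ->
  (forall x, P [set w | (S w <= x)%R] = Q [set w | (S' w <= x)%R]) ->
  forall A, measurable A -> P (S @^-1` A) = Q (S' @^-1` A).
Proof.
move=> mS mS' PQ A mA.
have [m1 m1E] := image_measure P mS.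
have [m2 m2E] := image_measure Q mS'.
rewrite -m1E -m2E; apply: measure_unique_Nyitv => //.
  by rewrite m1E preimage_setT -[X in X < _]/(P setT) probability_setT ltry.
by move=> x; rewrite m1E m2E preimage_itvNyc; exact: PQ.
Qed.

(** Independence makes the joint law a product, and Tonelli integrates the null sections. *)
Lemma pair_law_section0 d (T0 : measurableType d)
    (P : probability T0 R) (S T : T0 -> R) (D : set (R * R)) :
  measurable_fun setT S -> measurable_fun setT T ->
  (forall A B, measurable A -> measurable B ->
     P (S @^-1` A `&` T @^-1` B) = P (S @^-1` A) * P (T @^-1` B)) ->
  measurable D ->
  (forall t, P [set w | D (S w, t)] = 0) ->
  P [set w | D (S w, T w)] = 0.
Proof.
move=> mS mT ind mD D0.
have mP := measurable_fun_pair mS mT.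
pose FS : {mfun T0 >-> R} := HB.pack S (isMeasurableFun.Build _ _ _ _ _ mS).
pose FT : {mfun T0 >-> R} := HB.pack T (isMeasurableFun.Build _ _ _ _ _ mT).
have [m2 m2E] := image_measure P mP.
rewrite -[LHS]m2E -(@product_measure_unique _ _ _ _ R (distribution P FS) (distribution P FT))//.
  pose f (st : R * R) := (\1_D st)%:E : \bar R.
  rewrite -[X in _ X = _](setIT D) -integral_indic// fubini_tonelli2//; last first.
    by apply/measurable_EFinP; exact: measurable_indic.
  rewrite integral0_eq// => t _; rewrite /fubini_G.
  transitivity (distribution P FS (ysection D t `&` setT)).
    rewrite -integral_indic//; last exact: measurable_ysection.
    by apply: eq_integral => z _; rewrite !indicE mem_ysection.
  rewrite setIT /distribution /pushforward -[RHS](D0 t); congr (P _).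
  by apply/seteqP; split => w /=; rewrite ysectionE.
by move=> A B mA mB; rewrite m2E; exact: ind.
Qed.

Lemma quantile_atomless d (T : measurableType d) (P : probability T R) (K : T -> R) (q : R) :
  measurable_fun setT K -> (forall c, P [set w | K w = c] = 0) -> (0 < q < 1)%R ->
  P [set w | (K w <= quantile P K q)%R] = q%:E.
Proof.
move=> mK K0 /andP[q0 q1].
pose FK : {RV P >-> R} := HB.pack K (isMeasurableFun.Build _ _ _ _ _ mK).
have cdfE t : cdf FK t = P [set w | (K w <= t)%R].
  by rewrite /cdf /distribution /pushforward preimage_itvNyc.
set A := [set t : R | q%:E <= P [set w | (K w <= t)%R]].
have AE t : A t = (q%:E <= cdf FK t) by rewrite cdfE.
have cdf_mono : {homo cdf FK : x y / (x <= y)%R >-> x <= y} := cdf_nondecreasing FK.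
(* The infimum avoids its default value because A is nonempty (q < 1) and bounded below (0 < q). *)
have A0 : A !=set0.
  have Fy : \forall t \near +oo%R, q%:E < cdf FK t.
    have nb : nbhs (1 : \bar R) [set y | q%:E < y].
      by apply: open_nbhs_nbhs; split; [exact: open_ereal_gt_ereal|rewrite /= lte_fin].
    exact: (cvg_cdfy1 FK nb).
  by have [t Ft] := filter_ex Fy; exists t; rewrite AE ltW.
have lbA : has_lbound A.
  have FN : \forall t \near -oo%R, cdf FK t < q%:E.
    have nb : nbhs (0 : \bar R) [set y | y < q%:E].
      by apply: open_nbhs_nbhs; split; [exact: open_ereal_lt_ereal|rewrite /= lte_fin].
    exact: (cvg_cdfNy0 FK nb).
  have [t Ft] := filter_ex FN; exists t => x; rewrite AE => Ax.
  rewrite leNgt; apply/negP => /ltW/cdf_mono xt.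
  by have := lt_le_trans Ft (le_trans Ax xt); rewrite ltxx.
have -> : quantile P K q = inf A by [].
set a := inf A.
apply/le_anti/andP; split; last first.
  rewrite -cdfE; have rc : cdf FK t @[t --> a^'+] --> cdf FK a by exact: cdf_right_continuous.
  apply: (cvge_ge _ rc).
  near=> t; have at_ : (a < t)%R by near: t; exact: nbhs_right_gt.
  have [x Ax xt] := inf_lt A0 at_.
  by move: Ax; rewrite AE => /le_trans; apply; exact/cdf_mono/ltW.
(* Right continuity gave the lower bound q. From the left only P(K < a) <= q is available; the
   missing atom at a makes it P(K <= a) <= q. *)
pose C n := [set w | (K w <= a - n.+1%:R^-1)%R].
have mC c : measurable [set w | (K w <= c)%R].
  rewrite -preimage_itvNyc -[X in measurable X]setTI.
  by apply: (mK measurableT); exact: measurable_itv.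
have mCu : measurable (\bigcup_n C n) by apply: bigcupT_measurable => n; exact: mC.
have mKa : measurable [set w | K w = a].
  by rewrite -[X in measurable X]setTI; apply: (mK measurableT [set a]); exact: measurable_set1.
have -> : [set w | (K w <= a)%R] = \bigcup_n C n `|` [set w | K w = a].
  apply/seteqP; split => w /=.
    rewrite le_eqVlt => /predU1P[->|Ka]; [by right|left].
    have [n /ltW nK] := ltr_add_invr Ka.
    by exists n => //=; rewrite /C /= lerBrDr.
  move=> [[n _ /= Cn]|->//].
  by rewrite (le_trans Cn)// gerBl.
rewrite (measureU0 mCu mKa (K0 a)).
have Cc : P (C n) @[n --> \oo] --> P (\bigcup_n C n).
  apply: nondecreasing_cvg_mu => [n| |i j ij]; [exact: mC|exact: mCu|].
  apply/subsetPset => w /= /le_trans; apply.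
  by rewrite lerD2l lerN2 lef_pV2 ?posrE// ler_nat.
apply: (cvge_le _ Cc); near=> n.
rewrite leNgt; apply/negP => /ltW; rewrite -/(A (a - n.+1%:R^-1)%R) => Ca.
by have := ge_inf lbA Ca; rewrite -/a leNgt ltrBlDr ltrDl invr_gt0 ltr0n.
Unshelve. all: by end_near.
Qed.

End laws.

(** * Measurability and absence of atoms *)

Section kolmogorov_measurability.
Context {R : realType}.

(** Inversion is discontinuous at 0; on each side of it the inverse is written through exp and ln,
    and 0 is sent to 0. *)
Lemma measurable_invr : measurable_fun setT (fun x : R => x^-1).
Proof.
have -> : (fun x : R => x^-1) = (fun x => if 0 < x then expR (- ln x)
    else if x < 0 then - expR (- ln (- x)) else 0).
  apply/funext => x; have [x0|x0|<-] := ltgtP 0 x; last by rewrite invr0.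
    by rewrite expRN lnK ?posrE.
  by rewrite expRN lnK ?posrE ?oppr_gt0// invrN opprK.
have mN : measurable_fun setT (fun x : R => - x) by exact: oppr_measurable.
have mln : measurable_fun setT (@ln R) by exact: measurable_ln.
have mexp : measurable_fun setT (@expR R) by exact: measurable_expR.
apply: measurable_fun_ifT.
- exact: measurable_fun_ltr.
- by apply: (measurableT_comp mexp); exact: (measurableT_comp mN).
apply: measurable_fun_ifT => //; first exact: measurable_fun_ltr.
apply: (measurableT_comp mN); apply: (measurableT_comp mexp).
by apply: (measurableT_comp mN); exact: (measurableT_comp mln).
Qed.

Lemma continuous_Fexp (mu sigma : R) : continuous (Fexp mu sigma).
Proof.
have -> : Fexp mu sigma = (fun y => 1 - expR (- y / sigma)) \o (fun x => Num.max (x - mu) 0).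
  by apply/funext => x; rewrite FexpE.
move=> x; apply: continuous_comp.
  apply: continuous_max; last exact: cst_continuous.
  by apply: continuousB => //; exact: cst_continuous.
apply: continuousB; first exact: cst_continuous.
apply: continuous_comp; last exact: continuous_expR.
by apply: continuousM; [exact: oppr_continuous|exact: cst_continuous].
Qed.

Lemma Fexp_ge0_le1 (mu sigma x : R) : 0 <= sigma -> 0 <= Fexp mu sigma x <= 1.
Proof.
move=> s0; rewrite FexpE subr_ge0 gerBl expR_ge0 andbT -expR0 ler_expR mulNr oppr_le0.
by rewrite divr_ge0// le_max lexx orbT.
Qed.

Context d (Omega : measurableType d) (m s : Omega -> R).
Hypotheses (mm : measurable_fun setT m) (ms : measurable_fun setT s).

Lemma measurable_Fexp x : measurable_fun setT (fun w => Fexp (m w) (s w) x).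
Proof.
under eq_fun do rewrite FexpE.
apply: measurable_funB => //; apply: (measurableT_comp (@measurable_expR R)).
apply: measurable_funM; last exact: (measurableT_comp measurable_invr).
apply: (measurableT_comp (@oppr_measurable R _)) => //.
by apply: measurable_maxr => //; exact: measurable_funB.
Qed.

Variables mu sigma : R.
Hypothesis sigma0 : 0 < sigma.

(** By continuity in x it suffices to test rational x, which makes the condition countable. *)
Lemma measurable_band c :
  measurable [set w | forall x, `|Fexp (m w) (s w) x - Fexp mu sigma x| <= c].
Proof.
pose g w x := `|Fexp (m w) (s w) x - Fexp mu sigma x|.
have -> : [set w | forall x, g w x <= c] =
    ~` (\bigcup_(q : rat) [set w | c < g w (ratr q)]).
  apply/seteqP; split => w /=.
    by move=> H [q _] /=; rewrite ltNge H.
  move=> H x; rewrite leNgt; apply/negP => cx.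
  have cg : continuous (g w).
    by move=> y; apply: cvg_norm; apply: cvgB; exact: continuous_Fexp.
  have oO : open (g w @^-1` [set y | c < y]).
    by apply: open_comp => [y _|]; [exact: cg|exact: open_gt].
  have [y [gy [q _ qy]]] := dense_rat (ex_intro _ x cx) oO.
  by apply: H; exists q => //=; rewrite qy.
apply: measurableC; apply: bigcupT_measurable_rat => q.
have mg : measurable_fun setT (fun w => g w (ratr q)).
  apply: (measurableT_comp (@normr_measurable R _)) => //.
  by apply: measurable_funB => //; exact: measurable_Fexp.
rewrite (_ : [set _ | _] = (fun w => g w (ratr q)) @^-1` `]c, +oo[).
  by rewrite -[X in measurable X]setTI; apply: mg => //; exact: measurable_itv.
by apply/seteqP; split => w /=; rewrite in_itv/= andbT.
Qed.

Let K w := sup (range (fun x => `|Fexp (m w) (s w) x - Fexp mu sigma x|)).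

Lemma sup_range_le_band w c : 0 <= s w ->
  K w <= c <-> forall x, `|Fexp (m w) (s w) x - Fexp mu sigma x| <= c.
Proof.
move=> sw; split => [Kc x|H].
  apply: le_trans Kc; apply: ub_le_sup; last by exists x.
  exists 1 => _ [y _ <-].
  have := Fexp_ge0_le1 (m w) y sw; have := Fexp_ge0_le1 mu y (ltW sigma0).
  by move=> /andP[? ?] /andP[? ?]; rewrite ler_norml; apply/andP; split; lra.
apply: ge_sup; last by move=> _ [x _ <-].
by exists (`|Fexp (m w) (s w) 0 - Fexp mu sigma 0|); exists 0.
Qed.

Lemma band_scale_ge0 w c :
  (forall x, `|Fexp (m w) (s w) x - Fexp mu sigma x| <= c) -> 0 <= s w.
Proof.
move=> H; rewrite leNgt; apply/negP => sw.
have c0 : 0 <= c by apply: le_trans (H 0).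
(* With a negative scale the exponent at this point is c + 1, and exp(c + 1) >= c + 2 pushes the
   difference beyond c. *)
pose x := m w - s w * (c + 1).
have := H x; have /andP[F0 F1] := Fexp_ge0_le1 mu x (ltW sigma0).
have mx : m w < x by rewrite /x ltrBrDl gtrDr nmulr_rlt0//; lra.
rewrite {1}/Fexp [x <= m w]leNgt mx /= ler_norml => /andP[+ _].
rewrite (_ : - (x - m w) / s w = c + 1); last first.
  by rewrite /x; field; rewrite lt_eqF.
by have := expR_ge1Dx (c + 1); lra.
Qed.

Lemma measurable_sup_range : measurable_fun setT K.
Proof.
have msw : measurable [set w | s w < 0].
  rewrite (_ : [set _ | _] = s @^-1` `]-oo, 0[).
    by rewrite -[X in measurable X]setTI; apply: ms => //; exact: measurable_itv.
  by apply/seteqP; split => w /=; rewrite in_itv.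
(* A negative scale makes the differences unbounded, so [sup] returns its default 0; hence the
   second piece of the union below. *)
have K0 w : s w < 0 -> K w = 0.
  move=> sw; rewrite /K sup_out// => -[_ [M HM]].
  have : 0 <= s w by apply: (@band_scale_ge0 w M) => x; apply: HM; exists x.
  by rewrite leNgt sw.
have mK c : measurable [set w | K w <= c].
  rewrite (_ : [set w | K w <= c] =
     [set w | forall x, `|Fexp (m w) (s w) x - Fexp mu sigma x| <= c] `|`
     ([set w | s w < 0] `&` [set w | 0 <= c])); last first.
    apply/seteqP; split => w /=.
      have [sw|sw] := leP 0 (s w); first by move/(sup_range_le_band _ sw); left.
      by rewrite K0// => c0; right.
    case=> [H|[sw c0]]; first by apply/sup_range_le_band => //; exact: band_scale_ge0 H.
    by rewrite K0.
  apply: measurableU; first exact: measurable_band.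
  apply: measurableI => //.
  have [c0|c0] := leP 0 c.
    by rewrite (_ : [set _ | _] = setT)//; apply/seteqP; split.
  by rewrite (_ : [set _ | _] = set0)//; apply/seteqP; split.
move=> mT; apply: (measurability _ (RGenOInfty.measurableE R)) => // _ [_ [c ->] <-].
rewrite setTI (_ : K @^-1` _ = ~` [set w | K w <= c]); first exact: measurableC.
by apply/seteqP; split => w /=; rewrite in_itv/= andbT ltNge => /negP.
Qed.

End kolmogorov_measurability.

Section kolmogorov_law.
Context {R : realType}.

Lemma measurable_kolm :
  measurable_fun setT (fun st : R * R => Num.max (kolm_U st.1) (kolm_V st.1 st.2)).
Proof.
have m1 : measurable_fun setT (@fst R R) by exact: measurable_fst.
have m2 : measurable_fun setT (@snd R R) by exact: measurable_snd.
have mln : measurable_fun setT (fun st : R * R => ln st.2).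
  exact: (measurableT_comp (@measurable_ln R)).
have mexp := @measurable_expR R.
apply: measurable_maxr.
  apply: measurable_funB => //; apply: (measurableT_comp mexp).
  exact: (measurableT_comp (@oppr_measurable R setT)).
apply: measurable_funM.
  apply: measurable_funM.
    by apply: (measurableT_comp (@normr_measurable R setT)); exact: measurable_funB.
  apply: (measurableT_comp mexp); apply: measurable_funM.
    by apply: measurable_funB => //; exact: measurable_funM.
  by apply: (measurableT_comp measurable_invr); exact: measurable_funB.
apply: measurable_funD; apply: measurable_fun_ifT => //; exact: measurable_fun_ltr.
Qed.

Lemma kolm_U_inj : injective (@kolm_U R).
Proof. by move=> x y /(congr1 (fun z => 1 - z)); rewrite !subKr => /expR_inj/oppr_inj. Qed.

(** Where V is nonzero the sum of indicators is 1, and the exponent is affine in s with slope 1 / (t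
    - 1). *)
Lemma kolm_V_uniq (s s' t : R) : 0 < s -> 0 < s' ->
  kolm_V s t != 0 -> kolm_V s t = kolm_V s' t -> s = s'.
Proof.
move=> s0 s0'.
have t1 : kolm_V s t != 0 -> t != 1.
  by apply: contra => /eqP ->; rewrite /kolm_V subrr normr0 !mul0r.
have fac u : 0 < u -> kolm_V u t != 0 ->
    (if t < 1 then 1 else 0) + (if u < ln t then 1 else 0) = 1 :> R.
  move=> u0; rewrite /kolm_V; case: ltP => [tlt1|_].
    by rewrite ifF ?addr0//; apply/negbTE; rewrite -leNgt (le_trans _ (ltW u0))// ln_le0// ltW.
  by case: ifP; rewrite ?add0r// mulr0 eqxx.
move=> V0 VV; have V0' : kolm_V s' t != 0 by rewrite -VV.
have nt : t - 1 != 0 by rewrite subr_eq0 t1.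
move: VV; rewrite /kolm_V (fac _ s0 V0) (fac _ s0' V0') !mulr1.
move=> /mulfI; rewrite normr_eq0 subr_eq0 eq_sym t1// => /(_ isT) /expR_inj.
by move=> /(mulIf (invr_neq0 nt)) /addIr.
Qed.

Lemma kolm_atomless d (Omega : measurableType d) (P : probability Omega R)
    (S T : Omega -> R) :
  measurable_fun setT S -> measurable_fun setT T ->
  (forall A B, measurable A -> measurable B ->
     P (S @^-1` A `&` T @^-1` B) = P (S @^-1` A) * P (T @^-1` B))%E ->
  (forall x, P [set w | S w = x] = 0%E) -> P [set w | S w <= 0] = 0%E ->
  forall c, P [set w | Num.max (kolm_U (S w)) (kolm_V (S w) (T w)) = c] = 0%E.
Proof.
move=> mS mT ind Sx S0 c.
pose D : set (R * R) := [set st | Num.max (kolm_U st.1) (kolm_V st.1 st.2) = c].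
apply: (pair_law_section0 (D := D)) => //.
  rewrite (_ : D = (fun st : R * R => Num.max (kolm_U st.1) (kolm_V st.1 st.2)) @^-1` [set c])//.
  by rewrite -[X in measurable X]setTI; apply: measurable_kolm => //; exact: measurable_set1.
move=> t; apply/eqP; rewrite eq_le measure_ge0 andbT.
have mx x : measurable [set w | S w = x].
  by rewrite -[X in measurable X]setTI; apply: (mS measurableT [set x]); exact: measurable_set1.
have sub1 (A : set R) : (forall x y, A x -> A y -> x = y) ->
    exists x, A `<=` [set x].
  move=> A1; have [[x Ax]|nA] := pselect (exists x, A x).
    by exists x => y Ay; rewrite /= (A1 _ _ Ax Ay).
  by exists 0 => y Ay; case: nA; exists y.
have [u Hu] : exists u, [set x | kolm_U x = c] `<=` [set u].
  by apply: sub1 => x y /= <- /kolm_U_inj.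
(* V may vanish on a whole range of s, so c = 0 is left out; it cannot occur for S > 0, where the
   maximum is at least U > 0. *)
have [v Hv] : exists v, [set x | [/\ 0 < x, kolm_V x t = c & c != 0]] `<=` [set v].
  apply: sub1 => x y /= [x0 <- c0] [y0 yc _]; exact: (kolm_V_uniq x0 y0 c0).
have mle : measurable [set w | S w <= 0].
  rewrite -preimage_itvNyc -[X in measurable X]setTI.
  by apply: (mS measurableT); exact: measurable_itv.
have mN : measurable ([set w | S w <= 0] `|` ([set w | S w = u] `|` [set w | S w = v])).
  by apply: measurableU => //; exact: measurableU.
have N0 : P ([set w | S w <= 0] `|` ([set w | S w = u] `|` [set w | S w = v])) = 0%E.
  have Nuv : P ([set w | S w = u] `|` [set w | S w = v]) = 0%E.
    by rewrite (measureU0 (mx u) (mx v) (Sx v)); exact: Sx.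
  by rewrite (measureU0 mle (measurableU _ _ (mx u) (mx v)) Nuv); exact: S0.
rewrite -N0; apply: le_measure; rewrite ?inE//.
  have mf : measurable_fun setT (fun w => Num.max (kolm_U (S w)) (kolm_V (S w) t)).
    exact: (measurableT_comp measurable_kolm (measurable_fun_pair mS (measurable_cst t))).
  rewrite -[X in measurable X]setTI.
  by apply: (mf measurableT [set c]); exact: measurable_set1.
move=> w /= Dw; have [S0w|S0w] := leP (S w) 0; [by left|right].
move: Dw; rewrite /D /= => cE.
have U0 : 0 < kolm_U (S w) by rewrite subr_gt0 -expR0 ltr_expR oppr_lt0.
move: cE; case: leP => [UV|VU] cE; last by left; apply: Hu.
by right; apply: Hv; split => //; rewrite -cE gt_eqF// (lt_le_trans U0).
Qed.

End kolmogorov_law.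

(** * The pivots *)

Section pivots.
Context {R : realType}.
Variables (m n : nat) (Rs : nat -> nat) (mu sigma : R).
Context d (Omega : measurableType d) (P : probability Omega R) (X : nat -> Omega -> R).
Hypotheses (m1 : (1 < m)%N) (gam0 : gam m Rs 0 = n) (sigma0 : 0 < sigma).
Hypothesis sample : is_pcos_sample P m Rs mu sigma X.

Definition pivot_S (w : Omega) : R := (mu_hat X w - mu) / sigma.
Definition pivot_T (w : Omega) : R := sigma_hat m Rs X w / sigma.

Let mX j : (j < m)%N -> measurable_fun setT (X j).
Proof. by move=> jm; have [+ _] := sample; exact. Qed.

Lemma measurable_sigma_hat : measurable_fun setT (sigma_hat m Rs X).
Proof.
apply: measurable_funM => //.
suff H k : (k <= m)%N -> measurable_fun setT
    (fun w => \sum_(1 <= j < k) (gam m Rs j)%:R * (X j w - X j.-1 w)) by exact: H.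
elim: k => [|[|k] IH] km.
- by under eq_fun do rewrite big_geq//; exact: measurable_cst.
- by under eq_fun do rewrite big_geq//; exact: measurable_cst.
under eq_fun do rewrite big_nat_recr//=.
apply: measurable_funD; first exact/IH/ltnW.
apply: measurable_funM => //; apply: measurable_funB; first exact: mX.
exact/mX/ltnW.
Qed.

Lemma measurable_pivot_S : measurable_fun setT pivot_S.
Proof.
apply: measurable_funM => //; apply: measurable_funB => //; apply: mX.
exact: ltnW.
Qed.

Lemma measurable_pivot_T : measurable_fun setT pivot_T.
Proof. by apply: measurable_funM => //; exact: measurable_sigma_hat. Qed.

(** Noise of mean 1 / m makes T an unweighted sum of m - 1 noise variables. *)
Let b : R := m%:R^-1.
Let b0 : 0 < b. Proof. by rewrite invr_gt0 ltr0n ltnW. Qed.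
Let n0 : (0 < n)%N. Proof. by rewrite -gam0 gam_gt0// ltnW. Qed.
(** Rescales noise of mean b to mean 1 / n, the mean of S. *)
Let c : R := (n%:R * b)^-1.
Let c0 : 0 < c. Proof. by rewrite invr_gt0 mulr_gt0// ltr0n. Qed.

Lemma pivot_rect (E : probability R R) :
  (forall A, measurable A -> E A = \int[lebesgue_measure]_(x in A) (gamma_pdf 1 b x)%:E)%E ->
  forall A B : set R, measurable A -> measurable B ->
  (P (pivot_S @^-1` A `&` pivot_T @^-1` B) =
   E [set e | A (c * e)%R] * gamma_law b m.-1 B)%E.
Proof.
move=> EE A B mA mB.
have mA' : measurable [set x | A ((x - mu) / sigma)].
  have mf : measurable_fun setT (fun x : R => (x - mu) / sigma).
    by apply: measurable_funM => //; exact: measurable_funB.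
  by rewrite -[X in measurable X]setTI; exact: mf.
have := pcos_spacing_law b0 sigma0 EE (ltnW m1) sample mA' mB.
have -> : [set e | [set x | A ((x - mu) / sigma)] (mu + noise_scale b sigma m Rs 0 * e)] =
    [set e | A (c * e)].
  apply/funext => e /=; congr A.
  by rewrite /noise_scale gam0 /c; field; rewrite !gt_eqF// ltr0n.
move=> <-; congr (P _); apply/seteqP; split => w /= [Sw Tw]; split => //; move: Tw;
  congr B; rewrite /pivot_T /sigma_hat /spacing_sum prednK ?(ltnW m1)//;
  rewrite mulr_sumr mulr_suml; apply: eq_bigr => i _; rewrite /noise_scale invrK -/b; ring.
Qed.

Let gamE B : gamma_law b m.-1 B = (\int[lebesgue_measure]_(x in B) (gamma_pdf m.-1 b x)%:E)%E.
Proof. by case: m m1 @b => [|[|k]]. Qed.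

Lemma pivot_law :
  [/\ forall x : R, P [set w | pivot_S w <= x] = (Fexp 0 (n%:R^-1) x)%:E,
      forall B : set R, measurable B -> P (pivot_T @^-1` B) =
        (\int[lebesgue_measure]_(x in B) (gamma_pdf m.-1 (m%:R^-1) x)%:E)%E,
      forall A B : set R, measurable A -> measurable B ->
        P (pivot_S @^-1` A `&` pivot_T @^-1` B) =
        (P (pivot_S @^-1` A) * P (pivot_T @^-1` B))%E &
      forall x : R, P [set w | pivot_S w = x] = 0%E].
Proof.
have [E EE] := gamma1_law b0.
have rect := pivot_rect EE.
(* The total mass of the gamma law is read off from the full rectangle rather than computed. *)
have gT : gamma_law b m.-1 setT = 1%E.
  have := rect _ _ measurableT measurableT.
  rewrite !preimage_setT setTI -[X in X = _]/(P setT) probability_setT.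
  by rewrite -[X in (X * _)%E]/(E setT) probability_setT mul1e.
have SE A : measurable A -> P (pivot_S @^-1` A) = E [set e | A (c * e)].
  by move=> mA; have := rect _ _ mA measurableT; rewrite preimage_setT setIT gT mule1.
have TE B : measurable B -> P (pivot_T @^-1` B) = gamma_law b m.-1 B.
  move=> mB; have := rect _ _ measurableT mB; rewrite preimage_setT setTI.
  by rewrite -[X in (X * _)%E]/(E setT) probability_setT mul1e.
split => [x|B mB|A B mA mB|x].
- rewrite -preimage_itvNyc SE//.
  have -> : [set e | `]-oo, x]%classic (c * e)] = `]-oo, x / c]%classic.
    by apply/seteqP; split => e /=; rewrite !in_itv/= ler_pdivlMr// mulrC.
  have cV0 : 0 < c^-1 by rewrite invr_gt0.
  rewrite (noise_Nyitv EE) /Fexp subr0 (pmulr_lle0 _ cV0).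
  have [//|x0] := leP x 0.
  congr (1 - expR _)%:E; rewrite /c invrK invrK.
  by field; rewrite gt_eqF.
- by apply: (etrans (TE _ mB)); exact: gamE.
- by rewrite rect//; congr (_ * _)%E; apply/esym; [exact: SE|exact: TE].
- transitivity (E [set e | [set x] (c * e)]); first exact: (SE _ (measurable_set1 x)).
  have -> : [set e | [set x] (c * e)] = [set x / c].
    apply/seteqP; split => e /=; first by move=> <-; rewrite mulrAC divff ?mul1r// gt_eqF.
    by move=> ->; rewrite mulrC mulfVK// gt_eqF.
  by rewrite EE ?integral_set1//; exact: measurable_set1.
Qed.

Lemma pivot_S_le0 : P [set w | pivot_S w <= 0] = 0%E.
Proof. by have [H _ _ _] := pivot_law; rewrite (H 0) /Fexp lexx. Qed.

Lemma pivot_T_le0 : P [set w | pivot_T w <= 0] = 0%E.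
Proof.
have [_ TE _ _] := pivot_law; rewrite -preimage_itvNyc.
rewrite (TE `]-oo, 0]%classic (measurable_itv _)).
by rewrite integral0_eq// => x; rewrite /= in_itv/= /gamma_pdf => ->.
Qed.

Lemma K_hat_pivot w :
  K_hat m Rs X mu sigma w = kolm_dist (pivot_S w) (pivot_T w).
Proof.
rewrite -(kolm_dist_standard mu _ _ sigma0) /K_hat.
rewrite (_ : mu + sigma * pivot_S w = mu_hat X w); last first.
  by rewrite /pivot_S; field; rewrite gt_eqF.
rewrite (_ : sigma * pivot_T w = sigma_hat m Rs X w)//.
by rewrite /pivot_T; field; rewrite gt_eqF.
Qed.

Lemma measurable_K_hat : measurable_fun setT (K_hat m Rs X mu sigma).
Proof.
apply: measurable_sup_range => //; last exact: measurable_sigma_hat.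
exact/mX/ltnW.
Qed.

Lemma K_hat_law (A : set R) : measurable A ->
  P (K_hat m Rs X mu sigma @^-1` A) =
  P [set w | A (Num.max (kolm_U (pivot_S w)) (kolm_V (pivot_S w) (pivot_T w)))].
Proof.
move=> mA.
have mle (f : Omega -> R) : measurable_fun setT f -> measurable [set w | f w <= 0].
  move=> mf; rewrite -preimage_itvNyc -[X in measurable X]setTI; by apply: mf.
have mS := mle _ measurable_pivot_S; have mT := mle _ measurable_pivot_T.
apply: (@measure_off_null _ _ _ P _ _
    ([set w | pivot_S w <= 0] `|` [set w | pivot_T w <= 0])).
- by rewrite -[X in measurable X]setTI; exact: measurable_K_hat.
- have mST := measurable_fun_pair measurable_pivot_S measurable_pivot_T.
  have mf : measurable_fun setT
      (fun w => Num.max (kolm_U (pivot_S w)) (kolm_V (pivot_S w) (pivot_T w))).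
    exact: (measurableT_comp measurable_kolm mST).
  by rewrite -[X in measurable X]setTI; exact: mf.
- exact: measurableU.
- by rewrite (measureU0 mS mT pivot_T_le0); exact: pivot_S_le0.
move=> w /= Nw; have S0 : 0 < pivot_S w by rewrite ltNge; apply/negP => ?; apply: Nw; left.
have T0 : 0 < pivot_T w by rewrite ltNge; apply/negP => ?; apply: Nw; right.
by rewrite K_hat_pivot kolm_distE// ltW.
Qed.

Lemma K_hat_atomless x : P [set w | K_hat m Rs X mu sigma w = x] = 0%E.
Proof.
have [_ _ ind Sx] := pivot_law.
have := kolm_atomless measurable_pivot_S measurable_pivot_T ind Sx pivot_S_le0 x.
by rewrite -(K_hat_law (measurable_set1 x)).
Qed.

Lemma K_hat_maxUV d' (Omega' : measurableType d') (Q : probability Omega' R)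
    (S T : Omega' -> R) :
  measurable_fun setT S -> measurable_fun setT T ->
  (forall x : R, Q [set w | S w <= x] = (Fexp 0 (n%:R^-1) x)%:E) ->
  (forall A : set R, measurable A -> Q (T @^-1` A) =
     (\int[lebesgue_measure]_(x in A) (gamma_pdf m.-1 (m%:R^-1) x)%:E)%E) ->
  (forall A B : set R, measurable A -> measurable B ->
     Q (S @^-1` A `&` T @^-1` B) = (Q (S @^-1` A) * Q (T @^-1` B))%E) ->
  forall A : set R, measurable A ->
  P (K_hat m Rs X mu sigma @^-1` A) =
  Q [set w | A (Num.max (kolm_U (S w)) (kolm_V (S w) (T w)))].
Proof.
move=> mS mT SE TE ind A mA; rewrite K_hat_law//.
have [SE' TE' ind' _] := pivot_law.
pose D : set (R * R) := [set st | A (Num.max (kolm_U st.1) (kolm_V st.1 st.2))].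
apply: (@eq_pair_law R _ _ _ _ P Q _ _ _ _ measurable_pivot_S measurable_pivot_T mS mT _ D).
  move=> A' B' mA' mB'; rewrite ind'// ind// TE// TE'//; congr (_ * _)%E.
  by apply: (eq_law_Nyitv measurable_pivot_S mS) => // x; rewrite SE SE'.
by rewrite -[X in measurable X]setTI; exact: measurable_kolm.
Qed.

End pivots.

Theorem theorem3 (R : realType) (m n : nat) (Rs : nat -> nat)
    (d : measure_display) (Omega : measurableType d)
    (P : R -> R -> probability Omega R) (X : nat -> Omega -> R) :
  (1 < m)%N -> (m <= n)%N ->
  (\sum_(j < m) Rs j)%N = (n - m)%N ->
  (forall mu sigma : R, 0 < sigma -> is_pcos_sample (P mu sigma) m Rs mu sigma X) ->
  let K := fun (mu sigma : R) (w : Omega) => K_hat m Rs X mu sigma w in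
  (* K_{hat theta} is a random variable *)
  (forall mu sigma : R, 0 < sigma -> measurable_fun setT (K mu sigma)) /\
  (* its distribution under P_theta does not depend on theta *)
  (forall mu1 sigma1 mu2 sigma2 : R, 0 < sigma1 -> 0 < sigma2 ->
     forall A : set R, measurable A ->
       P mu1 sigma1 (K mu1 sigma1 @^-1` A) = P mu2 sigma2 (K mu2 sigma2 @^-1` A)) /\
  (* K_{hat theta} =d max{U, V} *)
  (forall (d' : measure_display) (Omega' : measurableType d')
          (Q : probability Omega' R) (S T : Omega' -> R),
     measurable_fun setT S -> measurable_fun setT T ->
     (forall x : R, Q [set w | S w <= x] = (Fexp 0 (n%:R^-1) x)%:E) ->
     (forall A : set R, measurable A ->
        Q (T @^-1` A) = (\int[lebesgue_measure]_(x in A) (gamma_pdf m.-1 (m%:R^-1) x)%:E)%E) ->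
     (forall A B : set R, measurable A -> measurable B ->
        Q (S @^-1` A `&` T @^-1` B) = (Q (S @^-1` A) * Q (T @^-1` B))%E) ->
     let U := fun w => 1 - expR (- S w) in
     let V := fun w => `|1 - T w| * expR ((S w - T w * ln (T w)) / (T w - 1))
                        * ((if T w < 1 then 1 else 0) + (if S w < ln (T w) then 1 else 0)) in
     forall mu sigma : R, 0 < sigma ->
     forall A : set R, measurable A ->
       P mu sigma (K mu sigma @^-1` A) = Q ((fun w => Num.max (U w) (V w)) @^-1` A)) /\
  (* B_4 is a confidence band with exact confidence level 1 - p *)
  (forall p : R, 0 < p < 1 ->
   forall mu0 sigma0 : R, 0 < sigma0 ->
     let dp := quantile (P mu0 sigma0) (K mu0 sigma0) (1 - p) in
     exact_confidence_band P Fexp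
       (fun w => [set xy : R * R |
                   `|Fexp (mu_hat X w) (sigma_hat m Rs X w) xy.1 - xy.2| <= dp])
       (1 - p)).
Proof.
move=> m1 mn Rsum sample K.
have gam0 : gam m Rs 0 = n.
  rewrite /gam big_mkord; under eq_bigr do rewrite -addn1.
  by rewrite big_split /= Rsum sum1_card card_ord subnK.
have mK mu sigma : 0 < sigma -> measurable_fun setT (K mu sigma).
  move=> s0; exact: (measurable_K_hat m1 s0 (sample mu sigma s0)).
have Klaw mu sigma (s0 : 0 < sigma) := K_hat_maxUV m1 gam0 s0 (sample mu sigma s0).
have Keq mu1 sigma1 mu2 sigma2 : 0 < sigma1 -> 0 < sigma2 ->
    forall A : set R, measurable A ->
    P mu1 sigma1 (K mu1 sigma1 @^-1` A) = P mu2 sigma2 (K mu2 sigma2 @^-1` A).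
  (* The pivots under the second parameter serve as the reference pair (S, T) for the first. *)
  move=> s1 s2 A mA; have PL := pivot_law m1 gam0 s2 (sample mu2 sigma2 s2).
  case: PL => SE TE ind _.
  rewrite [RHS](K_hat_law m1 gam0 s2 (sample mu2 sigma2 s2) mA).
  have mS := measurable_pivot_S m1 (sample mu2 sigma2 s2).
  have mT := measurable_pivot_T (sample mu2 sigma2 s2).
  exact: (Klaw mu1 sigma1 s1 _ _ _ _ _ mS mT SE TE ind A mA).
split; [exact: mK|split; [exact: Keq|split]].
  move=> d' Omega' Q S T mS mT SE TE ind U V mu sigma s0 A mA.
  exact: Klaw.
move=> p /andP[p0 p1] mu0 sigma0 s0 dp mu sigma s1.
have msh := measurable_sigma_hat (sample mu sigma s1).
have mmu : measurable_fun setT (mu_hat X).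
  by have [mX _] := sample mu sigma s1; exact/mX/ltnW.
have bandE : [set w | graph (Fexp mu sigma) `<=` [set xy : R * R |
      `|Fexp (mu_hat X w) (sigma_hat m Rs X w) xy.1 - xy.2| <= dp]] =
    [set w | forall x, `|Fexp (mu_hat X w) (sigma_hat m Rs X w) x - Fexp mu sigma x| <= dp].
  apply/seteqP; split => w /= H; first by move=> x; exact: (H (x, Fexp mu sigma x)).
  by move=> [x y]; rewrite /graph /= => ->; exact: H.
have mband := measurable_band mmu msh mu sigma dp.
split.
- by rewrite bandE.
- exists set0; split => // w _ t x y /= Hx Hy z /andP[xz zy].
  move: Hx Hy; rewrite !ler_norml => /andP[? ?] /andP[? ?]; apply/andP; split; lra.
rewrite bandE.
have q01 : 0 < 1 - p < 1 by apply/andP; split; lra.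
rewrite -(quantile_atomless (mK _ _ s0)
  (K_hat_atomless m1 gam0 s0 (sample mu0 sigma0 s0)) q01).
have mitv : measurable `]-oo, dp]%classic := measurable_itv _.
transitivity (P mu sigma (K mu sigma @^-1` `]-oo, dp])); last first.
  rewrite (Keq mu sigma mu0 sigma0 s1 s0 _ mitv).
  by rewrite preimage_itvNyc.
(* The band event and K <= dp can differ only when [sigma_hat] is negative, inside this null set. *)
apply: (@measure_off_null _ _ _ (P mu sigma) _ _ [set w | pivot_T m Rs sigma X w <= 0]).
- exact: mband.
- by rewrite -[X in measurable X]setTI; apply: mK.
- have mT := measurable_pivot_T (sample mu sigma s1).
  by rewrite -preimage_itvNyc -[X in measurable X]setTI; exact: mT.
- exact: (pivot_T_le0 m1 gam0 s1 (sample mu sigma s1)).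
move=> w /= Tw; rewrite in_itv /=.
have s_ge0 : 0 <= sigma_hat m Rs X w.
  rewrite leNgt; apply/negP => sw; apply: Tw.
  by rewrite /pivot_T ltW// pmulr_llt0 ?invr_gt0.
by apply: iff_sym; exact: sup_range_le_band.
Qed.
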